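(* Let $0<\alpha<1$, let $c=re^{it}$ with $r>0$ and $-\pi/2<t<\pi/2$, and let $n$ be a positive integer. If a function $q\in\mathcal{H}[c^\alpha,n]$ satisfies the condition $$-\Theta_-<\arg\left(q(z)+\frac{zq'(z)}{q(z)}\right)<\Theta_+\quad\text{for all } |z|<1,$$ then $|\arg q(z)|<\pi\alpha/2$ for all $z\in\mathbb{D}$. Here $$\Theta_\pm=\arctan\left[\tan\frac{\pi\alpha}{2}+\frac{n(\xi_\pm-\xi_\pm^{-1})}{2r^\alpha\,\xi_\pm^{\alpha}\cos(\pi\alpha/2)\cos t}\right]$$ and $$\xi_\pm=\frac{\mp\alpha\sin t+\sqrt{1-\alpha^2\cos^2 t}}{1-\alpha}.$$
   Context: $\mathbb{D}=\{z\in\mathbb{C}:|z|<1\}$. For $a\in\mathbb{C}$ and a positive integer $n$, $\mathcal{H}[a,n]$ is the set of holomorphic functions $h$ on $\mathbb{D}$ of the form $h(z)=a+c_nz^n+c_{n+1}z^{n+1}+\cdots$. The power $c^\alpha=r^\alpha e^{i\alpha t}$ is the principal one. $\arg$ is the principal argument, and a condition on $\arg w$ includes $w\ne 0$. The condition on $q(z)+zq'(z)/q(z)$ is understood to include that $q(z)\neq0$ on $\mathbb{D}$. In $\Theta_\pm$ and $\xi_\pm$ upper signs correspond to upper signs, i.e. $\xi_+$ has $-\alpha\sin t$ and $\xi_-$ has $+\alpha\sin t$. *)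

(* Defs.v *)
From Stdlib Require Import Reals Lra.
From Coquelicot Require Import Coquelicot.

Open Scope R_scope.

Definition polar (r t : R) : C := (r * cos t, r * sin t).

(** Principal argument, with values in (-PI, PI]; see [Carg_bound] and
    [polar_Carg].  [Carg 0] is a junk value, so conditions on [Carg w]
    must be stated together with [w <> 0]. *)
Definition Carg (w : C) : R :=
  if Rle_dec 0 (Im w) then acos (Re w / Cmod w) else - acos (Re w / Cmod w).

(** Principal power of [c <> 0] with real exponent. *)
Definition Cpowr (c : C) (alpha : R) : C :=
  polar (Rpower (Cmod c) alpha) (alpha * Carg c).

Definition holomorphic_disk (q : C -> C) : Prop :=
  forall z : C, Cmod z < 1 -> ex_derive (K := C_AbsRing) (V := C_NormedModule) q z.

Definition Hclass (a : C) (n : nat) (q : C -> C) : Prop :=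
  holomorphic_disk q /\
  exists b : nat -> C,
    b 0%nat = a /\
    (forall k : nat, (0 < k < n)%nat -> b k = RtoC 0) /\
    (forall z : C, Cmod z < 1 ->
       is_pseries (K := C_AbsRing) (V := C_NormedModule) b z (q z)).

Definition xi_plus (alpha t : R) : R :=
  (- alpha * sin t + sqrt (1 - alpha ^ 2 * cos t ^ 2)) / (1 - alpha).

Definition xi_minus (alpha t : R) : R :=
  (alpha * sin t + sqrt (1 - alpha ^ 2 * cos t ^ 2)) / (1 - alpha).

Definition Theta (n : nat) (alpha r t xi : R) : R :=
  atan (tan (PI * alpha / 2) +
        INR n * (xi - / xi) /
        (2 * Rpower r alpha * Rpower xi alpha * cos (PI * alpha / 2) * cos t)).

Definition Theta_plus (n : nat) (alpha r t : R) : R :=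
  Theta n alpha r t (xi_plus alpha t).

Definition Theta_minus (n : nat) (alpha r t : R) : R :=
  Theta n alpha r t (xi_minus alpha t).

Lemma Cmod_ratio (w : C) : w <> RtoC 0 ->
  0 < Cmod w /\ -1 <= Re w / Cmod w <= 1 /\
  (Re w / Cmod w)² + (Im w / Cmod w)² = 1.
Proof.
intros Hw.
assert (Hm : 0 < Cmod w) by (apply Cmod_gt_0; exact Hw).
assert (Hs : (Re w / Cmod w)² + (Im w / Cmod w)² = 1).
{ pose proof (Cmod2_alt w) as H. unfold Rsqr.
  replace (Re w / Cmod w * (Re w / Cmod w) + Im w / Cmod w * (Im w / Cmod w))
    with ((Re w ^ 2 + Im w ^ 2) / Cmod w ^ 2) by (field; lra).
  rewrite <- H. field. lra. }
split; [exact Hm|]. split; [|exact Hs].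
unfold Rsqr in Hs. split; nra.
Qed.

Lemma Carg_bound (w : C) : w <> RtoC 0 -> - PI < Carg w <= PI.
Proof.
intros Hw. destruct (Cmod_ratio w Hw) as [Hm [Hr Hs]].
pose proof (acos_bound (Re w / Cmod w)) as Hb. pose proof PI_RGT_0.
unfold Carg. destruct (Rle_dec 0 (Im w)) as [Hi|Hi]; [lra|].
split; [|lra].
apply Ropp_lt_contravar. destruct Hb as [_ [Hb|Hb]]; [exact Hb|exfalso].
assert (Hc : Re w / Cmod w = -1).
{ rewrite <- (cos_acos (Re w / Cmod w)) by exact Hr. rewrite Hb. exact cos_PI. }
rewrite Hc in Hs.
assert (Him : Im w / Cmod w < 0).
{ apply Rmult_lt_reg_r with (Cmod w); [exact Hm|].
  unfold Rdiv. rewrite Rmult_assoc, Rinv_l by lra. lra. }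
unfold Rsqr in Hs. nra.
Qed.

Lemma polar_Carg (w : C) : w <> RtoC 0 -> polar (Cmod w) (Carg w) = w.
Proof.
intros Hw. destruct (Cmod_ratio w Hw) as [Hm [Hr Hs]].
assert (Hsin : sin (acos (Re w / Cmod w)) = Rabs (Im w) / Cmod w).
{ rewrite sin_acos by exact Hr.
  replace (1 - (Re w / Cmod w)²) with ((Im w / Cmod w)²) by lra.
  rewrite sqrt_Rsqr_abs. unfold Rdiv. rewrite Rabs_mult.
  rewrite (Rabs_pos_eq (/ Cmod w)); [reflexivity|].
  left. now apply Rinv_0_lt_compat. }
rewrite (surjective_pairing w) at 3. unfold polar, Carg.
destruct (Rle_dec 0 (Im w)) as [Hi|Hi].
- rewrite cos_acos by exact Hr. rewrite Hsin, Rabs_pos_eq by exact Hi.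
  apply f_equal2; unfold Re, Im; field; lra.
- rewrite cos_neg, sin_neg, cos_acos by exact Hr.
  rewrite Hsin, Rabs_left by lra.
  apply f_equal2; unfold Re, Im; field; lra.
Qed.

Lemma Cmod_polar (r t : R) : 0 < r -> Cmod (polar r t) = r.
Proof.
intros Hr. unfold Cmod, polar; simpl fst; simpl snd.
replace ((r * cos t) ^ 2 + (r * sin t) ^ 2) with (r ^ 2 * ((sin t)² + (cos t)²))
  by (unfold Rsqr; ring).
rewrite sin2_cos2, Rmult_1_r. apply sqrt_pow2. lra.
Qed.

Lemma Carg_polar (r t : R) : 0 < r -> - PI < t <= PI -> Carg (polar r t) = t.
Proof.
intros Hr Ht. unfold Carg. rewrite Cmod_polar by exact Hr.
unfold polar, Re, Im; simpl fst; simpl snd.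
replace (r * cos t / r) with (cos t) by (field; lra).
destruct (Rle_dec 0 (r * sin t)) as [Hi|Hi].
- apply acos_cos. split; [|lra]. apply Rnot_lt_le. intros Hn.
  assert (H : 0 < sin (- t)) by (apply sin_gt_0; lra).
  rewrite sin_neg in H. nra.
- rewrite <- (cos_neg t), acos_cos; [ring|].
  split; [|lra]. apply Rnot_lt_le. intros Hn. apply Hi.
  apply Rmult_le_pos; [lra|]. apply sin_ge_0; lra.
Qed.

(* Main.v *)
Require Import Defs.
From Stdlib Require Import Reals Lra Lia Arith List Classical ClassicalEpsilon.
From Coquelicot Require Import Coquelicot.

Open Scope R_scope.

(* Suppose that [q] leaves the sector [|arg| < beta], [beta = PI * alpha / 2], and let
   [z0] be a point of smallest modulus where [q] is on its boundary; write
   [Q = z0 q'(z0) / q(z0)].  As [q] maps the circle through [z0] into the closed sector,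
   [Q] is purely imaginary.  The branch [p = q^(1/alpha)] maps the disc of radius [|z0|]
   into the right half-plane, [p(0) = c] and [p(z0)] is imaginary, so the Schwarz lemma of
   order [n] for [(p - c) / (p + conj c)], differentiated along the radius of [z0], bounds
   [Im Q] from below by [alpha n |c - p(z0)|^2 / (2 |p(z0)| Re c)] in absolute value.
   Minimising over [|p(z0)|] gives [arg (q + Q) >= Theta_plus] on the upper ray and
   [<= - Theta_minus] on the lower one.

   All the complex analysis rests on second order expansions [jet f z a], meaning
   [f(z+h) = f(z) + a h + b h^2 + O(h^3)]: they make the mean of [|f|^2] over the four
   points [z + i^j h] at least [|f(z)|^2 - O(h^3)], whence the maximum principle. *)

(** * Second order expansions *)

(** The order three is dictated by the maximum principle. The mean of [eps |z|^2] over the four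
    points exceeds its value at the centre by [eps h^2]; this gain absorbs an error [O(h^3)] in the
    mean of [|f|^2], but not the [o(h)] of mere complex differentiability. Power series, [Cexp],
    [Clog] and inversion get their expansions from explicit estimates, and composition carries them
    to [p] and to the Schwarz quotient, so no contour integral enters. On the closed disc of radius
    [|z0|] the values of [q] lie in the closed sector and, being nonzero, off its vertex. The
    principal branch of [q^(1/alpha)] is therefore regular up to and including [z0], and the Schwarz
    inequality, an equality at [z0], can be differentiated there as a one-sided inequality in a real
    variable. The shape of [Theta] comes from the upper ray: with [q(z0) = R e^(i beta)],
    [R = |p(z0)|^alpha] and [Q = i k], the tangent of [arg (q + Q)] is
    [tan beta + k / (R cos beta)]. *)

Definition bigO (k : nat) (g : C -> C) : Prop :=
  exists K d : R, 0 <= K /\ 0 < d /\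
    forall h : C, Cmod h < d -> Cmod (g h) <= K * Cmod h ^ k.

Lemma bigO_ext (k : nat) (f g : C -> C) :
  (forall h : C, f h = g h) -> bigO k f -> bigO k g.
Proof.
intros E (K & d & HK & Hd & H). exists K, d. repeat split; auto.
intros h Hh. rewrite <- E. auto.
Qed.

Lemma bigO_plus (k : nat) (f g : C -> C) :
  bigO k f -> bigO k g -> bigO k (fun h => f h + g h)%C.
Proof.
intros (K & d & HK & Hd & H) (K' & d' & HK' & Hd' & H').
exists (K + K'), (Rmin d d'). repeat split; [lra| |].
- now apply Rmin_glb_lt.
- intros h Hh. eapply Rle_trans; [apply Cmod_triangle|].
  rewrite Rmult_plus_distr_r. apply Rplus_le_compat; [apply H | apply H'].
  + eapply Rlt_le_trans; [exact Hh | apply Rmin_l].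
  + eapply Rlt_le_trans; [exact Hh | apply Rmin_r].
Qed.

Lemma bigO_mult (j k : nat) (f g : C -> C) :
  bigO j f -> bigO k g -> bigO (j + k) (fun h => f h * g h)%C.
Proof.
intros (K & d & HK & Hd & H) (K' & d' & HK' & Hd' & H').
exists (K * K'), (Rmin d d'). repeat split; [nra| |].
- now apply Rmin_glb_lt.
- intros h Hh. rewrite Cmod_mult, pow_add.
  replace (K * K' * (Cmod h ^ j * Cmod h ^ k))
    with ((K * Cmod h ^ j) * (K' * Cmod h ^ k)) by ring.
  apply Rmult_le_compat; try apply Cmod_ge_0; [apply H | apply H'].
  + eapply Rlt_le_trans; [exact Hh | apply Rmin_l].
  + eapply Rlt_le_trans; [exact Hh | apply Rmin_r].
Qed.

Lemma bigO_const (c : C) : bigO 0 (fun _ => c).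
Proof.
exists (Cmod c), 1. repeat split; [apply Cmod_ge_0|lra|].
intros h _. simpl. lra.
Qed.

Lemma bigO_id : bigO 1 (fun h => h).
Proof. exists 1, 1. repeat split; try lra. intros h _. simpl. lra. Qed.

Lemma bigO_le (j k : nat) (f : C -> C) : (j <= k)%nat -> bigO k f -> bigO j f.
Proof.
intros Hjk (K & d & HK & Hd & H).
exists K, (Rmin d 1). repeat split; [lra| |].
- apply Rmin_glb_lt; lra.
- intros h Hh. pose proof (Rmin_l d 1). pose proof (Rmin_r d 1).
  eapply Rle_trans; [apply H; lra|].
  apply Rmult_le_compat_l; [lra|].
  replace k with (j + (k - j))%nat by lia. rewrite pow_add.
  rewrite <- (Rmult_1_r (Cmod h ^ j)) at 2.
  apply Rmult_le_compat_l; [apply pow_le, Cmod_ge_0|].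
  rewrite <- (pow1 (k - j)). apply pow_incr. split; [apply Cmod_ge_0|lra].
Qed.

(** Since [0 < k], [g] is also [O(h)]; the linear constant [K1] tells how small [h] must be for
    [g h] to enter the disc where the bound on [r] holds. *)
Lemma bigO_comp (j k : nat) (r g : C -> C) :
  (0 < k)%nat -> bigO j r -> bigO k g -> bigO (k * j) (fun h => r (g h)).
Proof.
intros Hk (K & d & HK & Hd & H) Hg.
destruct (bigO_le 1 k g Hk Hg) as (K1 & d1 & HK1 & Hd1 & H1).
destruct Hg as (K' & d' & HK' & Hd' & H').
set (e := Rmin (Rmin d' d1) (d / (K1 + 1))).
assert (Hp : 0 < d / (K1 + 1)) by (apply Rdiv_lt_0_compat; lra).
exists (K * K' ^ j), e. repeat split.
- apply Rmult_le_pos; [lra | now apply pow_le].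
- unfold e. repeat apply Rmin_glb_lt; assumption.
- intros h Hh.
  assert (E1 : e <= d') by (eapply Rle_trans; apply Rmin_l).
  assert (E2 : e <= d1) by (eapply Rle_trans; [apply Rmin_l | apply Rmin_r]).
  assert (E3 : e <= d / (K1 + 1)) by apply Rmin_r.
  assert (Hg : Cmod (g h) < d).
  { pose proof (Cmod_ge_0 h). specialize (H1 h ltac:(lra)). rewrite pow_1 in H1.
    assert (Cmod h * (K1 + 1) < d).
    { replace d with (d / (K1 + 1) * (K1 + 1)) by (field; lra).
      apply Rmult_lt_compat_r; lra. }
    nra. }
  eapply Rle_trans; [apply H, Hg|].
  rewrite Rmult_assoc, pow_mult, <- Rpow_mult_distr.
  apply Rmult_le_compat_l; [lra|]. apply pow_incr.
  split; [apply Cmod_ge_0 | apply H'; lra].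
Qed.

Definition jet (f : C -> C) (z a : C) : Prop :=
  exists b : C, bigO 3 (fun h => f (z + h) - (f z + a * h + b * (h * h)))%C.

Lemma jet_incr_bigO2 (f : C -> C) (z a : C) :
  jet f z a -> bigO 2 (fun h => f (z + h) - f z - a * h)%C.
Proof.
intros [b Hb].
apply bigO_ext with (fun h => (f (z + h) - (f z + a * h + b * (h * h))) + b * (h * h))%C;
  [intros h; ring|].
apply bigO_plus; [now apply bigO_le with 3%nat; [lia|]|].
apply (bigO_mult 0 2); [apply bigO_const|].
apply (bigO_mult 1 1); apply bigO_id.
Qed.

Lemma jet_incr (f : C -> C) (z a : C) :
  jet f z a -> bigO 1 (fun h => f (z + h) - f z)%C.
Proof.
intros H%jet_incr_bigO2.
apply bigO_ext with (fun h => (f (z + h) - f z - a * h) + a * h)%C; [intros h; ring|].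
apply bigO_plus; [now apply bigO_le with 2%nat; [lia|]|].
apply (bigO_mult 0 1); [apply bigO_const | apply bigO_id].
Qed.

Lemma bigO_zero (k : nat) (f : C -> C) : (forall h, f h = RtoC 0) -> bigO k f.
Proof.
intros H. exists 0, 1. repeat split; try lra.
intros h _. rewrite H, Cmod_0. lra.
Qed.

Lemma jet_const (c z : C) : jet (fun _ => c) z 0.
Proof. exists (RtoC 0). apply bigO_zero. intros h. ring. Qed.

Lemma jet_id (z : C) : jet (fun w => w) z 1.
Proof. exists (RtoC 0). apply bigO_zero. intros h. ring. Qed.

Lemma jet_plus (f g : C -> C) (z a b : C) :
  jet f z a -> jet g z b -> jet (fun w => f w + g w)%C z (a + b)%C.
Proof.
intros [a' Ha] [b' Hb]. exists (a' + b')%C.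
eapply bigO_ext; [|apply (bigO_plus _ _ _ Ha Hb)]. intros h; simpl; ring.
Qed.

Lemma jet_mult (f g : C -> C) (z a b : C) :
  jet f z a -> jet g z b -> jet (fun w => f w * g w)%C z (a * g z + f z * b)%C.
Proof.
intros Hf Hg. pose proof (jet_incr_bigO2 _ _ _ Hf) as Hf2.
pose proof (jet_incr_bigO2 _ _ _ Hg) as Hg2.
pose proof (jet_incr _ _ _ Hg) as Hg1.
destruct Hf as [a' Ha], Hg as [b' Hb]. exists (a' * g z + a * b + f z * b')%C.
(* With [Df], [Dg] the increments, the remainder is that of [f] times [g z], plus [f z] times that
   of [g], plus [Df Dg - a b h^2]; the last is [(Df - a h) Dg + a h (Dg - b h)]. *)
eapply bigO_ext; [|apply (bigO_plus 3 (fun h =>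
   (f (z + h) - (f z + a * h + a' * (h * h))) * g z
   + f z * (g (z + h) - (g z + b * h + b' * (h * h))))%C
   (fun h => (f (z + h) - f z - a * h) * (g (z + h) - g z)
     + a * (h * (g (z + h) - g z - b * h)))%C)].
- intros h; simpl; ring.
- apply bigO_plus.
  + apply (bigO_mult 3 0); [exact Ha | apply bigO_const].
  + apply (bigO_mult 0 3); [apply bigO_const | exact Hb].
- apply bigO_plus.
  + now apply (bigO_mult 2 1).
  + apply (bigO_mult 0 3); [apply bigO_const|].
    apply (bigO_mult 1 2); [apply bigO_id | assumption].
Qed.

Lemma jet_comp (f g : C -> C) (z a b : C) :
  jet f (g z) a -> jet g z b -> jet (fun w => f (g w)) z (a * b)%C.
Proof.
intros [a' Ha] Hg. pose proof (jet_incr_bigO2 _ _ _ Hg) as Hg2.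
pose proof (jet_incr _ _ _ Hg) as Hg1.
destruct Hg as [b' Hb]. exists (a * b' + a' * (b * b))%C.
(* The expansion of [f] is evaluated at the increment [Dg]; replacing [Dg^2] by [b^2 h^2] costs
   [(Dg - b h) (Dg + b h)], which is of order 2 + 1. *)
eapply bigO_ext; [|apply (bigO_plus 3 (fun h =>
   f (g z + (g (z + h) - g z)) - (f (g z) + a * (g (z + h) - g z)
       + a' * ((g (z + h) - g z) * (g (z + h) - g z))))%C
   (fun h => a * (g (z + h) - (g z + b * h + b' * (h * h)))
     + a' * ((g (z + h) - g z - b * h) * ((g (z + h) - g z) + b * h)))%C)].
- intros h; simpl.
  replace (g z + (g (z + h) - g z))%C with (g (z + h)%C) by ring. ring.
- exact (bigO_comp 3 1 _ _ Nat.lt_0_1 Ha Hg1).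
- apply bigO_plus; apply (bigO_mult 0 3); try apply bigO_const; [exact Hb|].
  apply (bigO_mult 2 1); [exact Hg2|]. apply bigO_plus; [exact Hg1|].
  apply (bigO_mult 0 1); [apply bigO_const | apply bigO_id].
Qed.

Lemma Cmod_ge_sub (x y : C) : Cmod x - Cmod y <= Cmod (x + y)%C.
Proof.
pose proof (Cmod_triangle (x + y) (- y)) as H. rewrite Cmod_opp in H.
replace (x + y + - y)%C with x in H by ring. lra.
Qed.

(** The remainder is exactly [- h^3 / (z^3 (z + h))], and [|h| < |z| / 2] keeps [|z + h|] above
    [|z| / 2]. *)
Lemma jet_inv (z : C) : z <> RtoC 0 -> jet Cinv z (- / (z * z))%C.
Proof.
intros Hz. assert (Hm : 0 < Cmod z) by now apply Cmod_gt_0.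
exists (/ (z * z * z))%C.
exists (/ (Cmod z ^ 3 * (Cmod z / 2))), (Cmod z / 2).
assert (H3 : 0 < Cmod z ^ 3) by now apply pow_lt.
repeat split; [|lra|].
- left. apply Rinv_0_lt_compat. apply Rmult_lt_0_compat; lra.
- intros h Hh. pose proof (Cmod_ge_sub z h) as Hs.
  assert (Hzh : (z + h)%C <> RtoC 0) by (apply Cmod_gt_0; lra).
  replace (/ (z + h) - (/ z + - / (z * z) * h + / (z * z * z) * (h * h)))%C
    with (- (h * h * h) / (z * z * z * (z + h)))%C by (field; auto).
  rewrite Cmod_div, Cmod_opp, !Cmod_mult
    by (repeat apply Cmult_neq_0; auto).
  unfold Rdiv at 1. rewrite Rmult_comm.
  apply Rmult_le_compat; [| |apply Rinv_le_contravar|].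
  + left. apply Rinv_0_lt_compat. repeat apply Rmult_lt_0_compat; lra.
  + pose proof (Cmod_ge_0 h). repeat apply Rmult_le_pos; lra.
  + apply Rmult_lt_0_compat; lra.
  + simpl. rewrite Rmult_1_r, <- !Rmult_assoc.
    apply Rmult_le_compat_l; [|lra]. repeat apply Rmult_le_pos; lra.
  + right. ring.
Qed.

Lemma jet_pow (f : C -> C) (z a : C) (k : nat) :
  jet f z a -> exists a', jet (fun w => Cpow (f w) k) z a'.
Proof.
intros Hf. induction k as [|k [a' IH]].
- exists (RtoC 0). exact (jet_const (RtoC 1) z).
- exists (a * Cpow (f z) k + f z * a')%C. exact (jet_mult _ _ _ _ _ Hf IH).
Qed.

Lemma jet_continuous (f : C -> C) (z a : C) (eps : R) :
  jet f z a -> 0 < eps ->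
  exists d : R, 0 < d /\ forall w, Cmod (w - z)%C < d -> Cmod (f w - f z)%C < eps.
Proof.
intros (K & d & HK & Hd & H)%jet_incr He.
exists (Rmin d (eps / (K + 1))).
assert (Hp : 0 < eps / (K + 1)) by (apply Rdiv_lt_0_compat; lra).
split; [now apply Rmin_glb_lt|]. intros w Hw.
pose proof (Rmin_l d (eps / (K + 1))). pose proof (Rmin_r d (eps / (K + 1))).
specialize (H (w - z)%C). simpl in H.
replace (z + (w - z))%C with w in H by ring.
eapply Rle_lt_trans; [apply H; lra|]. pose proof (Cmod_ge_0 (w - z)%C).
assert (Cmod (w - z)%C * (K + 1) < eps).
{ replace eps with (eps / (K + 1) * (K + 1)) by (field; lra).
  apply Rmult_lt_compat_r; lra. }
nra.
Qed.

(** Identifies the first coefficient of a jet with the [C_derive] of the hypothesis on [q]. *)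
Lemma jet_is_derive (f : C -> C) (z a : C) :
  jet f z a -> is_derive (K := C_AbsRing) (V := C_NormedModule) f z a.
Proof.
intros (K & d & HK & Hd & H)%jet_incr_bigO2. split.
{ apply (is_linear_scal_l (K := C_AbsRing) (V := C_NormedModule)). }
intros x Hx.
apply (is_filter_lim_locally_unique (K := C_AbsRing)
  (V := AbsRing_NormedModule C_AbsRing)) in Hx. subst x.
intros eps.
assert (Hp : 0 < eps / (K + 1)) by (apply Rdiv_lt_0_compat; [apply eps | lra]).
exists (mkposreal _ (Rmin_glb_lt _ _ _ Hd Hp)).
intros y0 Hy. generalize dependent (y0 : C). clear y0.
intros y Hy.
change (Cmod (y - z)%C < Rmin d (eps / (K + 1))) in Hy.
change (Cmod (f y - f z - (y - z) * a)%C <= eps * Cmod (y - z)%C).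
pose proof (Rmin_l d (eps / (K + 1))). pose proof (Rmin_r d (eps / (K + 1))).
specialize (H (y - z)%C). simpl in H.
replace (z + (y - z))%C with y in H by ring.
replace (f y - f z - (y - z) * a)%C with (f y - f z - a * (y - z))%C by ring.
eapply Rle_trans; [apply H; lra|]. pose proof (Cmod_ge_0 (y - z)%C).
assert (Cmod (y - z)%C * (K + 1) <= eps).
{ replace (pos eps) with (eps / (K + 1) * (K + 1)) by (field; lra).
  apply Rmult_le_compat_r; lra. }
nra.
Qed.

(** * Complex exponential and logarithm *)

Definition is_Rderive (f : R -> C) (s : R) (l : C) : Prop :=
  is_derive (fun u => fst (f u)) s (fst l) /\
  is_derive (fun u => snd (f u)) s (snd l).

(** The mean value inequality for the real and the imaginary part separately, whence the factor 2.
    The interval is symmetric because [bounded_variation] asks for the derivative on a ball around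
    [0]. *)
Lemma segment_bound (f df : R -> C) (D : R) :
  (forall s, -1 <= s <= 1 -> is_Rderive f s (df s) /\ Cmod (df s) <= D) ->
  Cmod (f 1 - f 0)%C <= 2 * D.
Proof.
intros H.
assert (H1 : Rabs (fst (f 1) - fst (f 0)) <= D * Rabs (1 - 0)).
{ apply (bounded_variation (fun s => fst (f s)) (fun s => fst (df s))). intros s Hs.
  rewrite !Rminus_0_r, Rabs_R1 in Hs. apply Rabs_le_between in Hs.
  destruct (H s Hs) as [[Hf _] Hd]. split; [exact Hf|].
  eapply Rle_trans; [apply re_le_Cmod | exact Hd]. }
assert (H2 : Rabs (snd (f 1) - snd (f 0)) <= D * Rabs (1 - 0)).
{ apply (bounded_variation (fun s => snd (f s)) (fun s => snd (df s))). intros s Hs.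
  rewrite !Rminus_0_r, Rabs_R1 in Hs. apply Rabs_le_between in Hs.
  destruct (H s Hs) as [[_ Hf] Hd]. split; [exact Hf|].
  eapply Rle_trans; [|exact Hd].
  eapply Rle_trans; [apply Rmax_r | apply Rmax_Cmod]. }
rewrite Rminus_0_r, Rabs_R1, Rmult_1_r in H1, H2.
replace (f 1 - f 0)%C with
  (RtoC (fst (f 1) - fst (f 0)) + Ci * RtoC (snd (f 1) - snd (f 0)))%C
  by (apply injective_projections; simpl; ring).
eapply Rle_trans; [apply Cmod_triangle|].
rewrite Cmod_mult, Cmod_Ci, !Cmod_R. lra.
Qed.

Definition Cexp (w : C) : C := polar (exp (fst w)) (snd w).

Lemma Cexp_plus (w h : C) : Cexp (w + h) = (Cexp w * Cexp h)%C.
Proof.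
unfold Cexp, polar. apply injective_projections; simpl;
  rewrite exp_plus, ?cos_plus, ?sin_plus; ring.
Qed.

Lemma Cexp_0 : Cexp 0 = 1%C.
Proof.
unfold Cexp, polar. simpl. rewrite exp_0, cos_0, sin_0.
apply injective_projections; simpl; ring.
Qed.

Lemma Cmod_Cexp (w : C) : Cmod (Cexp w) = exp (fst w).
Proof. apply Cmod_polar, exp_pos. Qed.

Lemma is_Rderive_Cexp (h : C) (s : R) :
  is_Rderive (fun u => Cexp (u * h)%C) s (h * Cexp (s * h))%C.
Proof.
unfold Cexp, polar. split; simpl; auto_derive; auto; unfold Rminus; ring.
Qed.

Lemma is_Rderive_sub_linear (f : R -> C) (s : R) (l c h : C) :
  is_Rderive f s l -> is_Rderive (fun u => f u - (c + u * h))%C s (l - h)%C.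
Proof.
intros [H1 H2]. split; simpl.
- apply (is_derive_plus (fun u => fst (f u))); [exact H1|].
  auto_derive; auto; ring.
- apply (is_derive_plus (fun u => snd (f u))); [exact H2|].
  auto_derive; auto; ring.
Qed.

Lemma is_Rderive_sub_quadratic (f : R -> C) (s : R) (l b : C) :
  is_Rderive f s l ->
  is_Rderive (fun u => f u - RtoC (u * u) * b)%C s (l - RtoC (2 * s) * b)%C.
Proof.
intros [H1 H2]. split; simpl.
- apply (is_derive_plus (fun u => fst (f u))); [exact H1|].
  auto_derive; auto; ring.
- apply (is_derive_plus (fun u => snd (f u))); [exact H2|].
  auto_derive; auto; ring.
Qed.

Lemma Cmod_real_mult_le (s : R) (h : C) : -1 <= s <= 1 -> Cmod (s * h)%C <= Cmod h.
Proof.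
intros Hs. rewrite Cmod_mult, Cmod_R. rewrite <- (Rmult_1_l (Cmod h)) at 2.
apply Rmult_le_compat_r; [apply Cmod_ge_0|]. now apply Rabs_le.
Qed.

(** Start of a chain: along [s h] the derivative of each Taylor remainder is [h] times the preceding
    remainder, so [segment_bound] raises the order by one and doubles the constant, from 3 to 6, 12
    and 24. *)
Lemma Cexp_taylor0 (h : C) : Cmod h <= 1 -> Cmod (Cexp h) <= 3.
Proof.
intros Hh. rewrite Cmod_Cexp. apply Rle_trans with (exp 1); [|apply exp_le_3].
pose proof (re_le_Cmod h) as H. apply Rabs_le_between in H. unfold Re in H.
assert (fst h <= 1) as [Hl|Hl] by lra; [left; now apply exp_increasing | now rewrite Hl; right].
Qed.

Lemma Cexp_taylor1 (h : C) : Cmod h <= 1 -> Cmod (Cexp h - 1)%C <= 6 * Cmod h.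
Proof.
intros Hh.
pose proof (segment_bound (fun s => Cexp (s * h)) (fun s => h * Cexp (s * h))%C
  (Cmod h * 3)) as H. cbv beta in H.
replace (Cexp (1 * h)) with (Cexp h) in H by (f_equal; ring).
replace (Cexp (0 * h)) with (RtoC 1) in H by (rewrite <- Cexp_0; f_equal; ring).
eapply Rle_trans; [apply H|lra].
intros s Hs. split; [apply is_Rderive_Cexp|]. rewrite Cmod_mult.
apply Rmult_le_compat_l; [apply Cmod_ge_0|]. apply Cexp_taylor0.
pose proof (Cmod_real_mult_le s h Hs). lra.
Qed.

Lemma Cexp_taylor2 (h : C) :
  Cmod h <= 1 -> Cmod (Cexp h - (1 + h))%C <= 12 * Cmod h ^ 2.
Proof.
intros Hh.
pose proof (segment_bound (fun s => Cexp (s * h) - (1 + s * h))%C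
  (fun s => h * Cexp (s * h) - h)%C (6 * Cmod h ^ 2)) as H. cbv beta in H.
replace (Cexp (1 * h) - (1 + 1 * h) - (Cexp (0 * h) - (1 + 0 * h)))%C
  with (Cexp h - (1 + h))%C in H.
2:{ replace (0 * h)%C with (RtoC 0) by ring. rewrite Cexp_0.
  replace (1 * h)%C with h by ring. ring. }
eapply Rle_trans; [apply H|lra].
intros s Hs. split; [apply is_Rderive_sub_linear, is_Rderive_Cexp|].
pose proof (Cmod_real_mult_le s h Hs) as Hsh.
replace (h * Cexp (s * h) - h)%C with (h * (Cexp (s * h) - 1))%C by ring.
rewrite Cmod_mult. pose proof (Cexp_taylor1 (s * h)) as H'. pose proof (Cmod_ge_0 h).
nra.
Qed.

Lemma Cexp_taylor3 (h : C) :
  Cmod h <= 1 -> Cmod (Cexp h - (1 + h) - / 2 * (h * h))%C <= 24 * Cmod h ^ 3.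
Proof.
intros Hh.
pose proof (segment_bound
  (fun s => Cexp (s * h) - (1 + s * h) - RtoC (s * s) * (/ 2 * (h * h)))%C
  (fun s => h * Cexp (s * h) - h - RtoC (2 * s) * (/ 2 * (h * h)))%C
  (12 * Cmod h ^ 3)) as H. cbv beta in H.
replace (Cexp (1 * h) - (1 + 1 * h) - RtoC (1 * 1) * (/ 2 * (h * h)) -
   (Cexp (0 * h) - (1 + 0 * h) - RtoC (0 * 0) * (/ 2 * (h * h))))%C
  with (Cexp h - (1 + h) - / 2 * (h * h))%C in H.
2:{ replace (0 * h)%C with (RtoC 0) by ring. rewrite Cexp_0.
  replace (1 * h)%C with h by ring. rewrite Rmult_1_r, Rmult_0_r. ring. }
eapply Rle_trans; [apply H|lra].
intros s Hs. split.
{ apply is_Rderive_sub_quadratic, is_Rderive_sub_linear, is_Rderive_Cexp. }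
pose proof (Cmod_real_mult_le s h Hs) as Hsh.
replace (h * Cexp (s * h) - h - RtoC (2 * s) * (/ 2 * (h * h)))%C
  with (h * (Cexp (s * h) - (1 + s * h)))%C.
2:{ rewrite RtoC_mult. field. }
rewrite Cmod_mult. pose proof (Cexp_taylor2 (s * h)) as H'.
pose proof (Cmod_ge_0 h). pose proof (Cmod_ge_0 (s * h)%C).
assert (Cmod (s * h)%C ^ 2 <= Cmod h ^ 2) by (apply pow_incr; lra).
simpl in *. nra.
Qed.

Lemma jet_Cexp (z : C) : jet Cexp z (Cexp z).
Proof.
exists (Cexp z * / 2)%C.
apply bigO_ext with (fun h => Cexp z * (Cexp h - (1 + h) - / 2 * (h * h)))%C.
{ intros h. rewrite Cexp_plus. ring. }
apply (bigO_mult 0 3); [apply bigO_const|].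
exists 24, 1. repeat split; try lra. intros h Hh. apply Cexp_taylor3. lra.
Qed.

(** The principal logarithm on the open right half-plane, which contains the closed sector without
    its vertex. *)
Definition Clog (w : C) : C := (ln (Cmod w), atan (snd w / fst w)).

Lemma is_Rderive_Clog (w h : C) (s : R) :
  0 < fst (w + s * h)%C ->
  is_Rderive (fun u => Clog (w + u * h)%C) s (h / (w + s * h))%C.
Proof.
destruct w as [x y], h as [a b]. unfold Clog, Cmod. simpl. intros Hp.
set (X := x + (s * a - 0 * b)) in *.
split; simpl; auto_derive.
- repeat rewrite ?Rmult_1_r. replace (x + (s * a + - (0 * b))) with X by (unfold X; ring).
  pose proof (pow2_ge_0 (y + (s * b + 0 * a))).
  assert (0 < X * X + (y + (s * b + 0 * a)) * (y + (s * b + 0 * a))) by nra.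
  repeat split; auto. now apply sqrt_lt_R0.
- repeat rewrite ?Rmult_1_r. replace (x + (s * a + - (0 * b))) with X by (unfold X; ring).
  set (Y := y + (s * b + 0 * a)).
  assert (0 < X * X + Y * Y) by nra.
  assert (0 < sqrt (X * X + Y * Y)) by now apply sqrt_lt_R0.
  assert (sqrt (X * X + Y * Y) * sqrt (X * X + Y * Y) = X * X + Y * Y)
    by (apply sqrt_sqrt; lra).
  fold X. fold Y.
  set (S := sqrt (X * X + Y * Y)) in *.
  apply Rmult_eq_reg_r with (S * S); [|nra].
  rewrite H1 at 2. field. lra.
- unfold X in Hp. lra.
- fold X. replace (x + (s * a + - (0 * b))) with X by (unfold X; ring).
  set (Y := y + (s * b + 0 * a)). field. split; nra.
Qed.

(** Along [z + s h] the remainder has derivative [h (s h)^2 / (z^2 (z + s h))]. The radius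
    [fst z / 2] keeps the segment in the half-plane and its points at least that far from [0]. *)
Lemma jet_Clog (z : C) : 0 < fst z -> jet Clog z (/ z)%C.
Proof.
intros Hz.
assert (Hle : fst z <= Cmod z).
{ pose proof (re_le_Cmod z) as H. apply Rabs_le_between in H. unfold Re in H. lra. }
assert (Hz0 : z <> RtoC 0) by (apply Cmod_gt_0; lra).
exists (- / (2 * (z * z)))%C.
exists (2 * / (Cmod z * Cmod z * (fst z / 2))), (fst z / 2).
assert (Hp : 0 < Cmod z * Cmod z * (fst z / 2)) by (repeat apply Rmult_lt_0_compat; lra).
repeat split; [|lra|].
{ apply Rmult_le_pos; [lra|]. left. now apply Rinv_0_lt_compat. }
intros h Hh.
pose proof (segment_bound
  (fun s => Clog (z + s * h) - (0 + s * (h / z)) - RtoC (s * s) * - (h * h / (2 * (z * z))))%C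
  (fun s => h / (z + s * h) - h / z - RtoC (2 * s) * - (h * h / (2 * (z * z))))%C
  (/ (Cmod z * Cmod z * (fst z / 2)) * Cmod h ^ 3)) as H. cbv beta in H.
assert (H2 : RtoC 2 <> 0) by (intros E; apply RtoC_inj in E; lra).
replace (Clog (z + 1 * h) - (0 + 1 * (h / z)) - RtoC (1 * 1) * - (h * h / (2 * (z * z))) -
  (Clog (z + 0 * h) - (0 + 0 * (h / z)) - RtoC (0 * 0) * - (h * h / (2 * (z * z)))))%C
 with (Clog (z + h) - (Clog z + / z * h + - / (2 * (z * z)) * (h * h)))%C in H.
2:{ replace (z + 1 * h)%C with (z + h)%C by ring.
  replace (z + 0 * h)%C with z by ring. rewrite Rmult_1_r, Rmult_0_r. field; auto. }
eapply Rle_trans; [apply H|lra].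
intros s Hs. pose proof (Cmod_real_mult_le s h Hs) as Hsh.
assert (Hf : fst z / 2 <= fst (z + s * h)%C).
{ pose proof (re_le_Cmod (s * h)) as H'. apply Rabs_le_between in H'. unfold Re in H'.
  change (fst (z + s * h)%C) with (fst z + fst (s * h)%C). lra. }
assert (Hc : fst z / 2 <= Cmod (z + s * h)%C).
{ pose proof (re_le_Cmod (z + s * h)) as H'. apply Rabs_le_between in H'.
  unfold Re in H'. lra. }
assert (Hn : (z + s * h)%C <> RtoC 0) by (apply Cmod_gt_0; lra).
split.
{ apply is_Rderive_sub_quadratic, is_Rderive_sub_linear, is_Rderive_Clog. lra. }
replace (h / (z + s * h) - h / z - RtoC (2 * s) * - (h * h / (2 * (z * z))))%C
  with (h * (s * h) * (s * h) / (z * z * (z + s * h)))%C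
  by (rewrite RtoC_mult; field; auto).
rewrite Cmod_div, !Cmod_mult by (repeat apply Cmult_neq_0; auto).
rewrite <- Cmod_mult. unfold Rdiv at 1. rewrite Rmult_comm.
pose proof (Cmod_ge_0 h). pose proof (Cmod_ge_0 (s * h)).
apply Rmult_le_compat.
- left. apply Rinv_0_lt_compat. repeat apply Rmult_lt_0_compat; lra.
- repeat apply Rmult_le_pos; lra.
- apply Rinv_le_contravar; [exact Hp|]. apply Rmult_le_compat_l; nra.
- simpl. rewrite Rmult_1_r, <- Rmult_assoc.
  repeat apply Rmult_le_compat; try lra. apply Rmult_le_pos; lra.
Qed.

(** * Maximum principle *)

Definition usc_on (K : C -> Prop) (u : C -> R) : Prop :=
  forall (p : C) (v : R), K p -> u p < v ->
    exists d : R, 0 < d /\ forall w, K w -> Cmod (w - p)%C < d -> u w < v.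

(* If the maximum is not attained, every point of [K] has a neighbourhood on which
   [u] is below some value of [u]; a finite subcover yields a contradiction. *)
Lemma usc_max (K : C -> Prop) (u : C -> R) (M : R) (p0 : C) :
  K p0 -> (forall p, K p -> Cmod p <= M) ->
  (forall p, ~ K p -> exists d, 0 < d /\ forall w, Cmod (w - p)%C < d -> ~ K w) ->
  usc_on K u ->
  exists p, K p /\ forall w, K w -> u w <= u p.
Proof.
intros Hp0 HM Hcl Hu. apply NNPP. intros Hno.
assert (Hmax : forall p, K p -> exists w, K w /\ u p < u w).
{ intros p Hp. apply NNPP. intros H. apply Hno. exists p. split; [exact Hp|].
  intros w Hw. apply Rnot_lt_le. intros Hl. apply H. now exists w. }
(* The factor 2 allows for a cover by squares: [|w - p|] is at most the sum of the two coordinate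
   differences. For [p] outside [K] the neighbourhood misses [K], and [p0] is only a default
   witness. *)
assert (Hloc : forall p : C, exists dv : posreal * C, K (snd dv) /\
  forall w, K w -> Cmod (w - p)%C < 2 * fst dv -> u w < u (snd dv)).
{ intros p. destruct (classic (K p)) as [Hp|Hp].
  - destruct (Hmax p Hp) as [w [Hw Hl]].
    destruct (Hu p (u w) Hp Hl) as [d [Hd H]].
    assert (Hd2 : 0 < d / 2) by lra.
    exists (mkposreal _ Hd2, w). simpl. split; [exact Hw|].
    intros w' Hw' Hc. apply H; [exact Hw'|lra].
  - destruct (Hcl p Hp) as [d [Hd H]].
    assert (Hd2 : 0 < d / 2) by lra.
    exists (mkposreal _ Hd2, p0). simpl. split; [exact Hp0|].
    intros w' Hw' Hc. exfalso. apply (H w'); [lra|exact Hw']. }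
apply choice in Hloc. destruct Hloc as [F HF].
set (pt := fun t : Compactness.Tn 2 R => (fst t, fst (snd t)) : C).
(* The finite cover is given under a double negation, which is enough as the goal is [False]. *)
apply (compactness_list 2 (- M, (- M, tt)) (M, (M, tt)) (fun t => fst (F (pt t)))).
intros [l Hl].
assert (Hbest : forall l' : list (Compactness.Tn 2 R), exists w, K w /\
  forall t, In t l' -> u (snd (F (pt t))) <= u w).
{ induction l' as [|t l' [w [Hw IH]]].
  - exists p0. split; [exact Hp0|]. intros t [].
  - destruct (Rle_dec (u w) (u (snd (F (pt t))))) as [Hle|Hle].
    + exists (snd (F (pt t))). split; [apply HF|].
      intros t' [->|Ht']; [lra|]. specialize (IH t' Ht'). lra.
    + exists w. split; [exact Hw|]. intros t' [->|Ht']; [lra|]. now apply IH. }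
destruct (Hbest l) as [w [Hw Hwl]].
destruct (Hl (fst w, (snd w, tt))) as [[t1 [t2 []]] [Ht [_ Hc]]].
{ pose proof (HM w Hw) as Hb. pose proof (Rmax_Cmod w) as Hx.
  pose proof (Rmax_l (Rabs (fst w)) (Rabs (snd w))).
  pose proof (Rmax_r (Rabs (fst w)) (Rabs (snd w))).
  assert (- M <= fst w <= M) by (apply Rabs_le_between; lra).
  assert (- M <= snd w <= M) by (apply Rabs_le_between; lra).
  repeat split; lra. }
destruct Hc as [Hc1 [Hc2 _]]. specialize (Hwl _ Ht).
change (pt (t1, (t2, tt))) with (t1, t2) in *.
destruct (HF (t1, t2)) as [_ HFt].
assert (u w < u (snd (F (t1, t2)))); [|lra].
apply HFt; [exact Hw|].
assert (Hs : Cmod (w - (t1, t2))%C <= Rabs (fst w - t1) + Rabs (snd w - t2)).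
{ replace (w - (t1, t2))%C with
    (RtoC (fst w - t1) + Ci * RtoC (snd w - t2))%C
    by (apply injective_projections; simpl; ring).
  eapply Rle_trans; [apply Cmod_triangle|].
  rewrite Cmod_mult, Cmod_Ci, !Cmod_R. lra. }
lra.
Qed.

Lemma Cmod2_plus_lower (p r : C) :
  Cmod p ^ 2 - 2 * Cmod p * Cmod r <= Cmod (p + r)%C ^ 2.
Proof.
pose proof (Cmod_ge_sub p r). pose proof (Cmod_ge_0 (p + r)%C).
pose proof (Cmod_ge_0 p). pose proof (Cmod_ge_0 r).
destruct (Rle_dec (Cmod p) (Cmod r)); nra.
Qed.

Definition root4 (j : nat) (h : R) : C := (Cpow Ci j * h)%C.

Lemma Cmod_root4 (j : nat) (h : R) : 0 <= h -> Cmod (root4 j h) = h.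
Proof.
intros Hh. unfold root4. rewrite Cmod_mult, Cmod_pow, Cmod_Ci, pow1, Cmod_R.
rewrite Rabs_pos_eq by exact Hh. ring.
Qed.

(* Parseval: the fourth roots of unity kill all cross terms. *)
Lemma quadratic_mean4 (f a b : C) (h : R) :
  Cmod (f + a * root4 0 h + b * (root4 0 h * root4 0 h))%C ^ 2
  + Cmod (f + a * root4 1 h + b * (root4 1 h * root4 1 h))%C ^ 2
  + Cmod (f + a * root4 2 h + b * (root4 2 h * root4 2 h))%C ^ 2
  + Cmod (f + a * root4 3 h + b * (root4 3 h * root4 3 h))%C ^ 2
  = 4 * (Cmod f ^ 2 + Cmod a ^ 2 * h ^ 2 + Cmod b ^ 2 * h ^ 4).
Proof.
rewrite !Cmod2_alt. destruct f as [f1 f2], a as [a1 a2], b as [b1 b2].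
simpl. ring.
Qed.

Lemma jet_mean4 (f : C -> C) (z a : C) :
  jet f z a -> exists L d : R, 0 <= L /\ 0 < d /\ forall h : R, 0 < h < d ->
    4 * Cmod (f z) ^ 2 - L * h ^ 3 <=
    Cmod (f (z + root4 0 h)%C) ^ 2 + Cmod (f (z + root4 1 h)%C) ^ 2
    + Cmod (f (z + root4 2 h)%C) ^ 2 + Cmod (f (z + root4 3 h)%C) ^ 2.
Proof.
intros [b (K & d & HK & Hd & H)].
set (N := Cmod (f z) + Cmod a + Cmod b).
pose proof (Cmod_ge_0 (f z)). pose proof (Cmod_ge_0 a). pose proof (Cmod_ge_0 b).
(* Let [P] be the quadratic part at one of the four points: [h <= 1] gives [|P| <= N], so replacing
   [f] by [P] loses at most [2 N K h^3] there. *)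
exists (8 * N * K), (Rmin d 1).
assert (0 <= N) by (unfold N; lra).
repeat split; [repeat apply Rmult_le_pos; lra | apply Rmin_glb_lt; lra|].
intros h Hh. pose proof (Rmin_l d 1). pose proof (Rmin_r d 1).
assert (Hk : forall j,
  Cmod (f z + a * root4 j h + b * (root4 j h * root4 j h))%C ^ 2 - 2 * N * K * h ^ 3
  <= Cmod (f (z + root4 j h)%C) ^ 2).
{ intros j. assert (Hm : Cmod (root4 j h) = h) by (apply Cmod_root4; lra).
  specialize (H (root4 j h)). rewrite Hm in H.
  set (P := (f z + a * root4 j h + b * (root4 j h * root4 j h))%C) in *.
  replace (f (z + root4 j h)%C) with (P + (f (z + root4 j h) - P))%C by ring.
  eapply Rle_trans; [|apply Cmod2_plus_lower].
  assert (HP : Cmod P <= N).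
  { unfold P. eapply Rle_trans; [apply Cmod_triangle|].
    pose proof (Cmod_triangle (f z) (a * root4 j h)) as Ht.
    assert (Cmod (a * root4 j h)%C <= Cmod a) by (rewrite Cmod_mult, Hm; nra).
    assert (h * h <= 1) by nra.
    assert (Cmod (b * (root4 j h * root4 j h))%C <= Cmod b) by (rewrite !Cmod_mult, Hm; nra).
    unfold N. lra. }
  assert (Hr : Cmod (f (z + root4 j h) - P)%C <= K * h ^ 3) by (apply H; lra).
  pose proof (Cmod_ge_0 P). pose proof (Cmod_ge_0 (f (z + root4 j h) - P)%C).
  assert (Cmod P * Cmod (f (z + root4 j h) - P)%C <= N * (K * h ^ 3))
    by (apply Rmult_le_compat; lra).
  lra. }
pose proof (quadratic_mean4 (f z) a b h) as Hq.
pose proof (Hk 0%nat). pose proof (Hk 1%nat). pose proof (Hk 2%nat). pose proof (Hk 3%nat).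
assert (0 <= Cmod a ^ 2 * h ^ 2) by (apply Rmult_le_pos; apply pow2_ge_0).
assert (0 <= Cmod b ^ 2 * h ^ 4).
{ apply Rmult_le_pos; [apply pow2_ge_0 | apply pow_le; lra]. }
lra.
Qed.

(** A maximum of [|f|^2 + eps |z|^2] in the punctured disc contradicts [jet_mean4]. At the origin,
    where no expansion is assumed, [f 0 = 0] makes this function vanish, so the maximum is not there
    either. *)
Lemma maximum_principle (f : C -> C) (rho B : R) :
  0 < rho -> 0 <= B -> f 0 = RtoC 0 ->
  (forall p eps, Cmod p <= rho -> 0 < eps ->
     exists d, 0 < d /\ forall w, Cmod (w - p)%C < d -> Cmod (f w - f p)%C < eps) ->
  (forall p, 0 < Cmod p < rho -> exists a, jet f p a) ->
  (forall p, Cmod p = rho -> Cmod (f p) <= B) ->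
  forall p, Cmod p <= rho -> Cmod (f p) <= B.
Proof.
intros Hrho HB Hf0 Hcont Hjet Hbd z1 Hz1. apply Rnot_lt_le. intros Hgt.
(* Thus [eps rho^2] is half the excess of [|f z1|^2] over [B^2], and the perturbed function is still
   smaller on the boundary circle than at [z1]. *)
set (eps := (Cmod (f z1) ^ 2 - B ^ 2) / (2 * rho ^ 2)).
assert (Hr2 : 0 < rho ^ 2) by (apply pow_lt; lra).
assert (Heps : 0 < eps) by (apply Rdiv_lt_0_compat; nra).
assert (Heps2 : eps * rho ^ 2 = (Cmod (f z1) ^ 2 - B ^ 2) / 2)
  by (unfold eps; field; lra).
set (u := fun z => Cmod (f z) ^ 2 + eps * Cmod z ^ 2).
destruct (usc_max (fun p => Cmod p <= rho) u rho z1) as [p [Hp Hmax]]; auto.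
- intros p Hp. exists (Cmod p - rho). split; [lra|]. intros w Hw Hc.
  pose proof (Cmod_ge_sub p (w - p)) as Ht.
  replace (p + (w - p))%C with w in Ht by ring. lra.
- intros p v Hp Hv.
  set (N := 2 * Cmod (f p) + 1 + eps * (2 * Cmod p + 1)).
  assert (HN : 0 < N).
  { pose proof (Cmod_ge_0 (f p)). pose proof (Cmod_ge_0 p). unfold N. nra. }
  set (e := Rmin 1 ((v - u p) / N)).
  assert (He : 0 < e).
  { apply Rmin_glb_lt; [lra|]. apply Rdiv_lt_0_compat; lra. }
  assert (He1 : e <= 1) by apply Rmin_l.
  assert (He2 : e * N <= v - u p).
  { replace (v - u p) with ((v - u p) / N * N) by (field; lra).
    apply Rmult_le_compat_r; [lra|apply Rmin_r]. }
  destruct (Hcont p e Hp He) as [d [Hd H]].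
  exists (Rmin d e). split; [now apply Rmin_glb_lt|]. intros w _ Hw.
  pose proof (Rmin_l d e). pose proof (Rmin_r d e).
  assert (Hw1 : Cmod (f w - f p)%C < e) by (apply H; lra).
  pose proof (Cmod_triangle (f p) (f w - f p)) as T1.
  replace (f p + (f w - f p))%C with (f w) in T1 by ring.
  pose proof (Cmod_triangle p (w - p)) as T2.
  replace (p + (w - p))%C with w in T2 by ring.
  pose proof (Cmod_ge_0 (f p)). pose proof (Cmod_ge_0 p).
  pose proof (Cmod_ge_0 (f w)). pose proof (Cmod_ge_0 w).
  assert (Q1 : Cmod (f w) ^ 2 < Cmod (f p) ^ 2 + (2 * Cmod (f p) + 1) * e) by nra.
  assert (Q2 : Cmod w ^ 2 <= Cmod p ^ 2 + (2 * Cmod p + 1) * e) by nra.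
  apply Rlt_le_trans with (u p + e * N); [|lra]. unfold u, N. nra.
- pose proof (Hmax z1 Hz1) as H1. unfold u in H1.
  pose proof (pow2_ge_0 (Cmod z1)).
  assert (Hin : 0 < Cmod p < rho).
  { split.
    - apply Cmod_gt_0. intros ->. rewrite Hf0, Cmod_0 in H1. nra.
    - destruct Hp as [Hp|Hp]; [exact Hp|].
      pose proof (Hbd p Hp). pose proof (Cmod_ge_0 (f p)). rewrite Hp in H1. nra. }
  destruct (Hjet p Hin) as [a Ha].
  destruct (jet_mean4 f p a Ha) as (L & d & HL & Hd & HLd).
  (* The last bound gives [L h^3 <= eps h^2], less than the gain [4 eps h^2] of the perturbation;
     the second keeps the four points in the disc. *)
  set (h := Rmin (Rmin (d / 2) ((rho - Cmod p) / 2)) (eps / (L + 1))).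
  assert (He3 : 0 < eps / (L + 1)) by (apply Rdiv_lt_0_compat; lra).
  assert (Hh : 0 < h) by (repeat apply Rmin_glb_lt; lra).
  assert (Hh1 : h <= d / 2) by (eapply Rle_trans; apply Rmin_l).
  assert (Hh2 : h <= (rho - Cmod p) / 2).
  { eapply Rle_trans; [apply Rmin_l | apply Rmin_r]. }
  assert (Hh3 : h * (L + 1) <= eps).
  { replace eps with (eps / (L + 1) * (L + 1)) by (field; lra).
    apply Rmult_le_compat_r; [lra | apply Rmin_r]. }
  assert (Hj : forall j, u (p + root4 j h)%C <= u p).
  { intros j. apply Hmax. eapply Rle_trans; [apply Cmod_triangle|].
    rewrite Cmod_root4; lra. }
  specialize (HLd h ltac:(lra)).
  pose proof (quadratic_mean4 p 1 0 h) as Hq.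
  replace (Cmod (RtoC 0)) with 0 in Hq by (now rewrite Cmod_0).
  rewrite Cmod_1 in Hq.
  assert (Hs : forall j, (p + 1 * root4 j h + 0 * (root4 j h * root4 j h))%C = (p + root4 j h)%C)
    by (intros; ring).
  rewrite !Hs in Hq.
  pose proof (Hj 0%nat) as J0. pose proof (Hj 1%nat) as J1.
  pose proof (Hj 2%nat) as J2. pose proof (Hj 3%nat) as J3.
  unfold u in J0, J1, J2, J3.
  assert (0 < h ^ 2) by now apply pow_lt.
  assert (4 * eps * h ^ 2 <= L * h ^ 3) by nra.
  assert (L * h ^ 3 <= eps * h ^ 2) by nra.
  nra.
Qed.

(** * Complex power series *)

Definition Cseries (u : nat -> C) (l : C) : Prop :=
  is_series (K := C_AbsRing) (V := C_NormedModule) u l.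

Lemma Cseries_ext (u v : nat -> C) (l : C) :
  (forall k, u k = v k) -> Cseries u l -> Cseries v l.
Proof. exact (is_series_ext u v l). Qed.

Lemma Cseries_minus (u v : nat -> C) (l m : C) :
  Cseries u l -> Cseries v m -> Cseries (fun k => u k - v k)%C (l - m)%C.
Proof. exact (is_series_minus u v l m). Qed.

Lemma Cseries_scal (c : C) (u : nat -> C) (l : C) :
  Cseries u l -> Cseries (fun k => c * u k)%C (c * l)%C.
Proof. exact (is_series_scal c u l). Qed.

Lemma Cseries_dominated (u : nat -> C) (v : nat -> R) :
  (forall k, Cmod (u k) <= v k) -> ex_series v -> exists l, Cseries u l.
Proof.
intros H Hv.
exact (ex_series_le (K := C_AbsRing) (V := C_CompleteNormedModule) u v H Hv).
Qed.

Lemma Cseries_norm_le (u : nat -> C) (l : C) (v : nat -> R) (V : R) :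
  Cseries u l -> is_series v V -> (forall k, Cmod (u k) <= v k) -> Cmod l <= V.
Proof.
intros Hu Hv H.
apply (is_lim_seq_le (fun N => norm (sum_n (G := C_NormedModule) u N)) (sum_n v) (Cmod l) V).
- intros N. eapply Rle_trans; [apply norm_sum_n_m|]. now apply sum_n_m_le.
- apply (filterlim_comp _ _ _ (sum_n (G := C_NormedModule) u) norm eventually (locally l)).
  + exact Hu.
  + apply (filterlim_norm (K := C_AbsRing) (V := C_NormedModule)).
- exact Hv.
Qed.

Lemma Cseries_terms_bounded (u : nat -> C) (l : C) :
  Cseries u l -> exists M : R, 0 <= M /\ forall k, Cmod (u k) <= M.
Proof.
intros H.
destruct (filterlim_bounded (K := C_AbsRing) (V := C_NormedModule) (sum_n u)
  (ex_intro _ l H)) as [M HM].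
change (forall N, Cmod (sum_n (G := C_NormedModule) u N) <= M) in HM.
pose proof (Cmod_ge_0 (sum_n (G := C_NormedModule) u 0)). pose proof (HM 0%nat) as HM0.
assert (0 <= M) by lra.
exists (2 * M). split; [lra|]. intros [|k].
- rewrite sum_O in HM0. lra.
- replace (u (S k)) with (sum_n (G := C_NormedModule) u (S k)
    + - sum_n (G := C_NormedModule) u k)%C.
  + eapply Rle_trans; [apply Cmod_triangle|]. rewrite Cmod_opp.
    pose proof (HM k). pose proof (HM (S k)). lra.
  + rewrite sum_Sn. change plus with Cplus. ring.
Qed.

Lemma pseries_Cseries (b : nat -> C) (z l : C) :
  is_pseries (K := C_AbsRing) (V := C_NormedModule) b z l ->
  Cseries (fun k => Cpow z k * b k)%C l.
Proof.
apply Cseries_ext. reflexivity.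
Qed.

(** Abel's argument: the terms at a point [T] between [s] and [1] are bounded, so those at [s] are
    dominated by a geometric sequence of ratio [s / T]. *)
Lemma pseries_abs_conv (b : nat -> C) (q : C -> C) (s : R) :
  (forall z, Cmod z < 1 -> Cseries (fun k => Cpow z k * b k)%C (q z)) ->
  0 <= s < 1 -> ex_series (fun k => Cmod (b k) * s ^ k).
Proof.
intros H Hs. set (T := (1 + s) / 2).
assert (HT : Cmod T = T) by (rewrite Cmod_R; apply Rabs_pos_eq; unfold T; lra).
destruct (Cseries_terms_bounded _ _ (H T ltac:(rewrite HT; unfold T; lra))) as [M [HM HMk]].
apply (ex_series_le (K := R_AbsRing) (V := R_CompleteNormedModule) _
  (fun k => M * (s / T) ^ k)).
- intros k. specialize (HMk k). rewrite Cmod_mult, Cmod_pow, HT in HMk.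
  assert (HTk : 0 < T ^ k) by (apply pow_lt; unfold T; lra).
  assert (Hsk : 0 <= s ^ k) by (apply pow_le; lra).
  change (Rabs (Cmod (b k) * s ^ k) <= M * (s / T) ^ k).
  rewrite Rabs_pos_eq by (apply Rmult_le_pos; [apply Cmod_ge_0|exact Hsk]).
  unfold Rdiv. rewrite Rpow_mult_distr, pow_inv.
  replace (M * (s ^ k * / T ^ k)) with (M / T ^ k * s ^ k) by (field; lra).
  apply Rmult_le_compat_r; [exact Hsk|].
  apply Rmult_le_reg_r with (T ^ k); [exact HTk|].
  unfold Rdiv. rewrite Rmult_assoc, Rinv_l by lra. lra.
- apply (ex_series_scal_l (K := R_AbsRing) (V := R_NormedModule)).
  apply ex_series_geom. unfold T. rewrite Rabs_pos_eq.
  + apply Rmult_lt_reg_r with ((1 + s) / 2); [lra|]. field_simplify; lra.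
  + apply Rdiv_le_0_compat; lra.
Qed.

(* [(z + h)^k = z^k + pow_d1 z k * h + pow_d2 z k * h^2 + pow_rem z h k]. *)
Fixpoint pow_d1 (z : C) (k : nat) : C :=
  match k with 0%nat => RtoC 0 | S k => (z * pow_d1 z k + Cpow z k)%C end.

Fixpoint pow_d2 (z : C) (k : nat) : C :=
  match k with 0%nat => RtoC 0 | S k => (z * pow_d2 z k + pow_d1 z k)%C end.

Definition pow_rem (z h : C) (k : nat) : C :=
  (Cpow (z + h) k - (Cpow z k + pow_d1 z k * h + pow_d2 z k * (h * h)))%C.

(** [pow_rem] is the binomial tail from degree 3 on, where [|h|^j eta^3 <= |h|^3 eta^j]; the bracket
    on the right is the same tail of [(|z| + eta)^k]. *)
Lemma pow_rem_bound (z h : C) (eta : R) (k : nat) :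
  0 < eta -> Cmod h <= eta ->
  Cmod (pow_rem z h k) * eta ^ 3 <=
  Cmod h ^ 3 * ((Cmod z + eta) ^ k -
    (Cmod z ^ k + Cmod (pow_d1 z k) * eta + Cmod (pow_d2 z k) * eta ^ 2)).
Proof.
intros Heta Hh. pose proof (Cmod_ge_0 z) as Hz. pose proof (Cmod_ge_0 h) as Hh0.
induction k as [|k IH].
- unfold pow_rem. simpl.
  replace (1 - (1 + 0 * h + 0 * (h * h)))%C with (RtoC 0) by ring.
  rewrite Cmod_0. lra.
- replace (pow_rem z h (S k))
    with ((z + h) * pow_rem z h k + pow_d2 z k * (h * h * h))%C
    by (unfold pow_rem; simpl; ring).
  assert (H1 : Cmod (pow_d1 z (S k)) <= Cmod z * Cmod (pow_d1 z k) + Cmod z ^ k).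
  { simpl. rewrite <- Cmod_mult, <- Cmod_pow. apply Cmod_triangle. }
  assert (H2 : Cmod (pow_d2 z (S k)) <= Cmod z * Cmod (pow_d2 z k) + Cmod (pow_d1 z k)).
  { simpl. rewrite <- Cmod_mult. apply Cmod_triangle. }
  assert (H3 : Cmod ((z + h) * pow_rem z h k + pow_d2 z k * (h * h * h))%C
    <= (Cmod z + eta) * Cmod (pow_rem z h k) + Cmod (pow_d2 z k) * Cmod h ^ 3).
  { eapply Rle_trans; [apply Cmod_triangle|]. rewrite !Cmod_mult.
    pose proof (Cmod_triangle z h). pose proof (Cmod_ge_0 (pow_rem z h k)).
    apply Rplus_le_compat; [|right; ring]. apply Rmult_le_compat_r; lra. }
  set (R' := Cmod (pow_rem z h k)) in *. set (D := Cmod (pow_d1 z k)) in *.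
  set (E := Cmod (pow_d2 z k)) in *. set (H := Cmod h ^ 3) in *.
  assert (HH : 0 <= H) by (apply pow_le; lra).
  assert (He3 : 0 < eta ^ 3) by (apply pow_lt; lra).
  set (P := (Cmod z + eta) ^ k) in *. set (Q := Cmod z ^ k) in *.
  apply Rle_trans with (((Cmod z + eta) * R' + E * H) * eta ^ 3).
  { apply Rmult_le_compat_r; lra. }
  apply Rle_trans with ((Cmod z + eta) * (H * (P - (Q + D * eta + E * eta ^ 2))) + E * H * eta ^ 3).
  { rewrite Rmult_plus_distr_r, Rmult_assoc.
    apply Rplus_le_compat_r, Rmult_le_compat_l; lra. }
  replace ((Cmod z + eta) * (H * (P - (Q + D * eta + E * eta ^ 2))) + E * H * eta ^ 3)
    with (H * ((Cmod z + eta) * P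
      - (Cmod z * Q + (Cmod z * D + Q) * eta + (Cmod z * E + D) * eta ^ 2))) by ring.
  apply Rmult_le_compat_l; [exact HH|]. simpl.
  change ((Cmod z + eta) ^ k) with P. change (Cmod z ^ k) with Q.
  apply Rplus_le_compat_l, Ropp_le_contravar.
  apply Rplus_le_compat; [apply Rplus_le_compat_l|]; apply Rmult_le_compat_r; nra || assumption.
Qed.

(** The bound on the remainder at [h = eta] has a nonnegative left side, so its bracket is
    nonnegative. *)
Lemma pow_d12_bound (z : C) (eta : R) (k : nat) : 0 < eta ->
  Cmod (pow_d1 z k) * eta <= (Cmod z + eta) ^ k /\
  Cmod (pow_d2 z k) * eta ^ 2 <= (Cmod z + eta) ^ k.
Proof.
intros He. assert (Hm : Cmod eta = eta) by (rewrite Cmod_R; apply Rabs_pos_eq; lra).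
pose proof (pow_rem_bound z eta eta k He ltac:(lra)) as H. rewrite Hm in H.
assert (He3 : 0 < eta ^ 3) by (apply pow_lt; lra).
assert (H0 : 0 <= Cmod (pow_rem z eta k) * eta ^ 3)
  by (apply Rmult_le_pos; [apply Cmod_ge_0 | lra]).
pose proof (pow_le _ k (Cmod_ge_0 z)).
assert (0 <= Cmod (pow_d1 z k) * eta) by (apply Rmult_le_pos; [apply Cmod_ge_0 | lra]).
assert (0 <= Cmod (pow_d2 z k) * eta ^ 2)
  by (apply Rmult_le_pos; [apply Cmod_ge_0 | apply pow2_ge_0]).
assert (0 <= (Cmod z + eta) ^ k -
  (Cmod z ^ k + Cmod (pow_d1 z k) * eta + Cmod (pow_d2 z k) * eta ^ 2)).
{ apply Rmult_le_reg_l with (eta ^ 3); lra. }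
lra.
Qed.

(** The powers are expanded term by term. With [T = |z| + eta < 1], multiples of the convergent
    series of [|b k| T^k] majorise both coefficient series and the remainder. *)
Lemma pseries_jet (b : nat -> C) (q : C -> C) (z : C) :
  (forall z, Cmod z < 1 -> Cseries (fun k => Cpow z k * b k)%C (q z)) ->
  Cmod z < 1 -> exists a, jet q z a.
Proof.
intros H Hz. pose proof (Cmod_ge_0 z) as Hz0.
set (eta := (1 - Cmod z) / 2). assert (Heta : 0 < eta) by (unfold eta; lra).
assert (He2 : 0 < eta ^ 2) by (apply pow_lt; lra).
assert (He3 : 0 < eta ^ 3) by (apply pow_lt; lra).
set (T := Cmod z + eta). assert (HT : 0 <= T < 1) by (unfold T, eta; lra).
pose proof (pseries_abs_conv b q T H HT) as Hex.
pose proof (Series_correct _ Hex) as HS.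
set (B := Series (fun k => Cmod (b k) * T ^ k)) in *.
assert (Hdom : forall (d : nat -> C) (m : R), 0 < m ->
  (forall k, Cmod (d k) * m <= T ^ k) -> exists l, Cseries (fun k => d k * b k)%C l).
{ intros d m Hm Hd. apply Cseries_dominated with (fun k => / m * (Cmod (b k) * T ^ k)).
  - intros k. rewrite Cmod_mult.
    apply Rmult_le_reg_l with m; [exact Hm|].
    replace (m * (/ m * (Cmod (b k) * T ^ k))) with (Cmod (b k) * T ^ k) by (field; lra).
    replace (m * (Cmod (d k) * Cmod (b k))) with (Cmod (b k) * (Cmod (d k) * m)) by ring.
    apply Rmult_le_compat_l; [apply Cmod_ge_0 | apply Hd].
  - now apply (ex_series_scal_l (K := R_AbsRing) (V := R_NormedModule)). }
destruct (Hdom (pow_d1 z) eta Heta (fun k => proj1 (pow_d12_bound z eta k Heta))) as [a Ha].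
destruct (Hdom (pow_d2 z) (eta ^ 2) He2 (fun k => proj2 (pow_d12_bound z eta k Heta))) as [c Hc].
exists a, c, (B / eta ^ 3), eta. repeat split; [|exact Heta|].
- apply Rdiv_le_0_compat; [|exact He3].
  replace 0 with (Cmod 0) by apply Cmod_0.
  apply (Cseries_norm_le (fun _ => RtoC 0) _ (fun k => Cmod (b k) * T ^ k)); [|exact HS|].
  + replace (RtoC 0) with (a - a)%C by ring.
    eapply Cseries_ext; [|exact (Cseries_minus _ _ _ _ Ha Ha)]. intros k; simpl; ring.
  + intros k. rewrite Cmod_0. apply Rmult_le_pos; [apply Cmod_ge_0 | apply pow_le; lra].
- intros h Hh.
  assert (Hzh : Cmod (z + h)%C < 1).
  { pose proof (Cmod_triangle z h). unfold eta in Hh. lra. }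
  replace (B / eta ^ 3 * Cmod h ^ 3) with (Cmod h ^ 3 / eta ^ 3 * B) by (field; lra).
  apply (Cseries_norm_le (fun k => pow_rem z h k * b k)%C _
    (fun k => Cmod h ^ 3 / eta ^ 3 * (Cmod (b k) * T ^ k))).
  + replace (q (z + h) - (q z + a * h + c * (h * h)))%C
      with (q (z + h) - q z - h * a - (h * h) * c)%C by ring.
    eapply Cseries_ext; [|exact (Cseries_minus _ _ _ _ (Cseries_minus _ _ _ _
      (Cseries_minus _ _ _ _ (H _ Hzh) (H _ Hz)) (Cseries_scal h _ _ Ha))
      (Cseries_scal (h * h) _ _ Hc))].
    intros k. unfold pow_rem. simpl. ring.
  + now apply (is_series_scal (K := R_AbsRing) (V := R_NormedModule)).
  + intros k. rewrite Cmod_mult. apply Rmult_le_reg_r with (eta ^ 3); [exact He3|].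
    replace (Cmod h ^ 3 / eta ^ 3 * (Cmod (b k) * T ^ k) * eta ^ 3)
      with (Cmod (b k) * (Cmod h ^ 3 * T ^ k)) by (field; lra).
    replace (Cmod (pow_rem z h k) * Cmod (b k) * eta ^ 3)
      with (Cmod (b k) * (Cmod (pow_rem z h k) * eta ^ 3)) by ring.
    apply Rmult_le_compat_l; [apply Cmod_ge_0|].
    eapply Rle_trans; [apply pow_rem_bound; lra|].
    apply Rmult_le_compat_l; [apply pow_le, Cmod_ge_0|].
    change (Cmod z + eta) with T.
    pose proof (pow_le _ k Hz0). pose proof (Cmod_ge_0 (pow_d1 z k)).
    pose proof (Cmod_ge_0 (pow_d2 z k)). nra.
Qed.

(** For [k >= n] and [|h| < 1/2] one has [|h|^k <= (2 |h|)^n 2^(-k)], which extracts the factor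
    [|h|^n] from the whole series at once. *)
Lemma pseries_vanishing_order (b : nat -> C) (q : C -> C) (n : nat) :
  (forall z, Cmod z < 1 -> Cseries (fun k => Cpow z k * b k)%C (q z)) ->
  (forall k, (0 < k < n)%nat -> b k = RtoC 0) ->
  bigO n (fun h => q h - b 0%nat)%C.
Proof.
intros H Hb.
pose proof (pseries_abs_conv b q (/ 2) H ltac:(lra)) as Hex.
apply ex_series_incr_1 in Hex. pose proof (Series_correct _ Hex) as HS.
(* The shift drops the constant term, which is subtracted from [q h]. *)
set (v := fun k => Cmod (b (S k)) * (/ 2) ^ S k) in HS.
assert (Hcoef : forall h k, Cmod h < / 2 ->
  Cmod (Cpow h (S k) * b (S k))%C <= (Cmod h * 2) ^ n * v k).
{ intros h k Hh. pose proof (Cmod_ge_0 h). unfold v. rewrite Cmod_mult, Cmod_pow.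
  destruct (Nat.le_gt_cases n (S k)) as [Hk|Hk].
  - replace (Cmod h ^ S k) with (Cmod h ^ n * Cmod h ^ (S k - n))
      by (rewrite <- pow_add; f_equal; lia).
    replace ((/ 2) ^ S k) with ((/ 2) ^ n * (/ 2) ^ (S k - n))
      by (rewrite <- pow_add; f_equal; lia).
    rewrite Rpow_mult_distr.
    replace (Cmod h ^ n * 2 ^ n * (Cmod (b (S k)) * ((/ 2) ^ n * (/ 2) ^ (S k - n))))
      with (Cmod h ^ n * (/ 2) ^ (S k - n) * Cmod (b (S k))).
    2:{ assert (H2 : 2 ^ n * (/ 2) ^ n = 1)
          by (rewrite <- Rpow_mult_distr, Rinv_r by lra; apply pow1).
        replace (Cmod h ^ n * 2 ^ n * (Cmod (b (S k)) * ((/ 2) ^ n * (/ 2) ^ (S k - n))))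
          with (2 ^ n * (/ 2) ^ n * (Cmod h ^ n * (/ 2) ^ (S k - n) * Cmod (b (S k))))
          by ring.
        rewrite H2. ring. }
    apply Rmult_le_compat_r; [apply Cmod_ge_0|].
    apply Rmult_le_compat_l; [now apply pow_le|]. apply pow_incr. lra.
  - rewrite Hb, Cmod_0 by lia. lra. }
exists (2 ^ n * Series v), (/ 2).
assert (Hbound : forall h, Cmod h < / 2 ->
  Cmod (q h - b 0%nat)%C <= 2 ^ n * Series v * Cmod h ^ n).
{ intros h Hh.
  replace (2 ^ n * Series v * Cmod h ^ n) with ((Cmod h * 2) ^ n * Series v)
    by (rewrite Rpow_mult_distr; ring).
  apply (Cseries_norm_le (fun k => Cpow h (S k) * b (S k))%C _
    (fun k => (Cmod h * 2) ^ n * v k)).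
  - apply (is_series_incr_1 (K := C_AbsRing) (V := C_NormedModule)
      (fun k => Cpow h k * b k)%C).
    change (Cseries (fun k => Cpow h k * b k)%C (q h - b 0%nat + Cpow h 0 * b 0%nat)%C).
    replace (q h - b 0%nat + Cpow h 0 * b 0%nat)%C with (q h) by (simpl; ring).
    apply H. lra.
  - now apply (is_series_scal (K := R_AbsRing) (V := R_NormedModule)).
  - intros k. now apply Hcoef. }
repeat split; [|lra|exact Hbound].
apply Rmult_le_pos; [apply pow_le; lra|].
pose proof (Cseries_norm_le (fun _ => RtoC 0) 0 v (Series v)) as H0.
rewrite Cmod_0 in H0. apply H0; [|exact HS|].
- pose proof (H 0 ltac:(rewrite Cmod_0; lra)) as Hs.
  pose proof (Cseries_minus _ _ _ _ Hs Hs) as Hm.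
  replace (q 0 - q 0)%C with (RtoC 0) in Hm by ring.
  eapply Cseries_ext; [|exact Hm]. intros k. simpl. ring.
- intros k. rewrite Cmod_0. unfold v. apply Rmult_le_pos; [apply Cmod_ge_0 | apply pow_le; lra].
Qed.

(** * Schwarz lemma of order n *)

(* The maximum principle is applied to [W^k / z^(nk-1)], which vanishes at [0] for
   every [k >= 1], so no removable singularity has to be treated; then [k -> oo]. *)
Lemma schwarz_order_power (W : C -> C) (rho : R) (n k : nat) :
  0 < rho -> (0 < n)%nat ->
  (forall p, Cmod p <= rho -> exists a, jet W p a) -> bigO n W ->
  (forall p, Cmod p = rho -> Cmod (W p) <= 1) ->
  forall p, Cmod p <= rho -> p <> RtoC 0 ->
  Cmod (W p) ^ S k * rho ^ (n * S k - 1) <= Cmod p ^ (n * S k - 1).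
Proof.
intros Hrho Hn Hjet HO Hbd p Hp Hp0.
assert (HNk : (n * S k = S (n * S k - 1))%nat) by nia.
set (N := (n * S k - 1)%nat) in *.
set (f := fun z => (Cpow (W z) (S k) * / Cpow z N)%C).
assert (HrN : 0 < rho ^ N) by now apply pow_lt.
assert (HW0 : W 0 = RtoC 0).
{ destruct HO as (K & d & _ & Hd & H). apply Cmod_eq_0.
  specialize (H 0). rewrite Cmod_0, pow_i in H by exact Hn.
  pose proof (Cmod_ge_0 (W 0)). pose proof (H Hd). lra. }
(* Whatever value the inverse takes at [0], the factor [W 0 = 0] occurs with exponent at least
   one. *)
assert (Hf0 : f 0 = RtoC 0) by (unfold f; rewrite HW0; simpl; ring).
assert (Hfmod : forall z, z <> RtoC 0 -> Cmod (f z) = Cmod (W z) ^ S k / Cmod z ^ N).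
{ intros z Hz. unfold f.
  rewrite Cmod_mult, Cmod_inv, !Cmod_pow by now apply Cpow_nz. reflexivity. }
assert (Hfjet : forall z, Cmod z <= rho -> z <> RtoC 0 -> exists a, jet f z a).
{ intros z Hz Hz0. destruct (Hjet z Hz) as [a Ha].
  destruct (jet_pow W z a (S k) Ha) as [a' Ha'].
  destruct (jet_pow (fun w => w) z 1 N (jet_id z)) as [b Hb].
  eexists. eapply jet_mult; [exact Ha'|].
  eapply (jet_comp Cinv (fun w => Cpow w N)); [|exact Hb].
  apply jet_inv. now apply Cpow_nz. }
assert (Hmax : Cmod (f p) <= / rho ^ N).
{ apply (maximum_principle f rho (/ rho ^ N)); auto.
  - left. now apply Rinv_0_lt_compat.
  - intros z eps Hz Heps. destruct (Ceq_dec z 0) as [->|Hz0].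
    + destruct HO as (K & d & HK & Hd & H).
      assert (HKk : 0 <= K ^ S k) by now apply pow_le.
      exists (Rmin d (eps / (K ^ S k + 1))).
      assert (Hq : 0 < eps / (K ^ S k + 1)) by (apply Rdiv_lt_0_compat; lra).
      split; [now apply Rmin_glb_lt|]. intros w Hw.
      replace (w - 0)%C with w in Hw by ring. rewrite Hf0.
      replace (f w - 0)%C with (f w) by ring.
      pose proof (Rmin_l d (eps / (K ^ S k + 1))).
      pose proof (Rmin_r d (eps / (K ^ S k + 1))).
      destruct (Ceq_dec w 0) as [->|Hw0]; [rewrite Hf0, Cmod_0; lra|].
      assert (Hwp : 0 < Cmod w) by now apply Cmod_gt_0.
      rewrite Hfmod by exact Hw0.
      assert (HwN : 0 < Cmod w ^ N) by now apply pow_lt.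
      (* The numerator is [O(|w|^(N + 1))] and the denominator [|w|^N]; the spare factor [|w|] gives
         continuity at [0]. *)
      apply Rle_lt_trans with (K ^ S k * Cmod w).
      * apply Rmult_le_reg_r with (Cmod w ^ N); [exact HwN|].
        unfold Rdiv. rewrite Rmult_assoc, Rinv_l, Rmult_1_r by lra.
        rewrite Rmult_assoc. change (Cmod w * Cmod w ^ N) with (Cmod w ^ S N).
        rewrite <- HNk, pow_mult, <- Rpow_mult_distr.
        apply pow_incr. split; [apply Cmod_ge_0 | apply H; lra].
      * assert (Cmod w * (K ^ S k + 1) < eps); [|lra].
        replace eps with (eps / (K ^ S k + 1) * (K ^ S k + 1)) by (field; lra).
        apply Rmult_lt_compat_r; lra.
    + destruct (Hfjet z Hz Hz0) as [a Ha]. now apply (jet_continuous f z a).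
  - intros z Hz. apply Hfjet; [lra|]. now apply Cmod_gt_0.
  - intros z Hz. rewrite Hfmod, Hz.
    2:{ apply Cmod_gt_0. lra. }
    unfold Rdiv. rewrite <- (Rmult_1_l (/ rho ^ N)) at 2.
    apply Rmult_le_compat_r; [left; now apply Rinv_0_lt_compat|].
    rewrite <- (pow1 (S k)). apply pow_incr. split; [apply Cmod_ge_0 | now apply Hbd]. }
rewrite Hfmod in Hmax by exact Hp0.
assert (HpN : 0 < Cmod p ^ N) by (apply pow_lt; now apply Cmod_gt_0).
apply Rmult_le_reg_r with (/ rho ^ N); [now apply Rinv_0_lt_compat|].
rewrite Rmult_assoc, Rinv_r, Rmult_1_r by lra.
apply Rmult_le_reg_r with (/ Cmod p ^ N); [now apply Rinv_0_lt_compat|].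
replace (Cmod p ^ N * / rho ^ N * / Cmod p ^ N) with (/ rho ^ N) by (field; lra).
exact Hmax.
Qed.

(** Replaces a limit of roots: by Bernoulli the powers of [x > 1] are unbounded. *)
Lemma pow_bounded_le_1 (x M : R) : (forall k : nat, x ^ S k <= M) -> x <= 1.
Proof.
intros H. apply Rnot_lt_le. intros Hx.
destruct (Rle_or_lt M 0) as [HM|HM].
{ specialize (H 0%nat). simpl in H. lra. }
destruct (INR_unbounded (M / (x - 1))) as [k Hk].
pose proof (poly (S k) (x - 1) ltac:(lra)) as Hb.
replace (1 + (x - 1)) with x in Hb by ring. rewrite S_INR in Hb.
specialize (H k).
assert (M < INR k * (x - 1)).
{ replace M with (M / (x - 1) * (x - 1)) by (field; lra).
  apply Rmult_lt_compat_r; lra. }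
nra.
Qed.

Lemma schwarz_order (W : C -> C) (rho : R) (n : nat) :
  0 < rho -> (0 < n)%nat ->
  (forall p, Cmod p <= rho -> exists a, jet W p a) -> bigO n W ->
  (forall p, Cmod p = rho -> Cmod (W p) <= 1) ->
  forall p, Cmod p <= rho -> p <> RtoC 0 -> Cmod (W p) * rho ^ n <= Cmod p ^ n.
Proof.
intros Hrho Hn Hjet HO Hbd p Hp Hp0.
assert (Hm : 0 < Cmod p) by now apply Cmod_gt_0.
assert (Hmn : 0 < Cmod p ^ n) by now apply pow_lt.
assert (Hx : Cmod (W p) * rho ^ n / Cmod p ^ n <= 1).
(* The bound [rho / |p|] is the price, independent of [k], of the exponent [n (k + 1) - 1] in place
   of [n (k + 1)]. *)
{ apply pow_bounded_le_1 with (rho / Cmod p). intros k.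
  pose proof (schwarz_order_power W rho n k Hrho Hn Hjet HO Hbd p Hp Hp0) as H.
  assert (HNk : (n * S k = S (n * S k - 1))%nat) by nia.
  unfold Rdiv. rewrite !Rpow_mult_distr, pow_inv, <- !pow_mult, HNk.
  set (N := (n * S k - 1)%nat) in *.
  assert (HpN : 0 < Cmod p ^ N) by now apply pow_lt.
  change (rho ^ S N) with (rho * rho ^ N). change (Cmod p ^ S N) with (Cmod p * Cmod p ^ N).
  replace (Cmod (W p) ^ S k * (rho * rho ^ N) * / (Cmod p * Cmod p ^ N))
    with (rho * / Cmod p * (Cmod (W p) ^ S k * rho ^ N * / Cmod p ^ N)) by (field; lra).
  rewrite <- (Rmult_1_r (rho * / Cmod p)) at 2.
  apply Rmult_le_compat_l.
  - left. apply Rmult_lt_0_compat; [exact Hrho | now apply Rinv_0_lt_compat].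
  - rewrite <- (Rinv_r (Cmod p ^ N)) by lra.
    apply Rmult_le_compat_r; [left; now apply Rinv_0_lt_compat | exact H]. }
apply Rmult_le_reg_r with (/ Cmod p ^ n); [now apply Rinv_0_lt_compat|].
rewrite Rinv_r by lra. exact Hx.
Qed.

(** * Derivatives at a boundary point of the disc *)

Lemma jet_is_Rderive (f : C -> C) (z a v : C) :
  jet f z a -> is_Rderive (fun s => f (z + s * v)%C) 0 (a * v)%C.
Proof.
intros Hf. pose proof (jet_incr_bigO2 f z a Hf) as H2.
assert (Hv : bigO 1 (fun h => h * v)%C).
{ apply (bigO_mult 1 0); [apply bigO_id | apply bigO_const]. }
destruct (bigO_comp 2 1 _ _ Nat.lt_0_1 H2 Hv) as (K & d & HK & Hd & H). simpl in H.
assert (Hs : forall eps, 0 < eps -> exists delta : posreal, forall s : R, s <> 0 ->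
  Rabs s < delta -> Cmod (f (z + s * v) - f z - a * (s * v))%C < eps * Rabs s).
{ intros eps He.
  assert (Hp : 0 < Rmin d (eps / (K + 1))).
  { apply Rmin_glb_lt; [exact Hd|]. apply Rdiv_lt_0_compat; lra. }
  exists (mkposreal _ Hp). simpl. intros s Hs0 Hs.
  pose proof (Rmin_l d (eps / (K + 1))). pose proof (Rmin_r d (eps / (K + 1))).
  specialize (H s). rewrite Cmod_R, Rmult_1_r in H.
  eapply Rle_lt_trans; [apply H; lra|].
  assert (0 < Rabs s) by now apply Rabs_pos_lt.
  assert (Rabs s * (K + 1) < eps).
  { replace eps with (eps / (K + 1) * (K + 1)) by (field; lra).
    apply Rmult_lt_compat_r; lra. }
  nra. }
assert (Hdiv : forall x y s e, s <> 0 -> Rabs (x - y * s) < e * Rabs s ->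
  Rabs (x / s - y) < e).
{ intros x y s e Hs0 Hlt. assert (0 < Rabs s) by now apply Rabs_pos_lt.
  apply Rmult_lt_reg_r with (Rabs s); [assumption|].
  rewrite <- Rabs_mult. replace ((x / s - y) * s) with (x - y * s) by (field; exact Hs0).
  exact Hlt. }
assert (H0 : (z + 0 * v)%C = z) by ring.
split; apply is_derive_Reals; intros eps He; destruct (Hs eps He) as [delta Hdelta];
  exists delta; intros s Hs0 Hsd; rewrite Rplus_0_l, H0; apply Hdiv; auto;
  (eapply Rle_lt_trans; [|apply (Hdelta s Hs0 Hsd)]);
  [ eapply Rle_trans; [|apply re_le_Cmod]
  | eapply Rle_trans; [|eapply Rle_trans; [apply Rmax_r | apply Rmax_Cmod]] ];
  right; unfold Re; f_equal; simpl; ring.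
Qed.

Lemma is_derive_right_nonneg (f : R -> R) (l : R) :
  is_derive f 0 l -> f 0 = 0 -> (forall s, 0 <= s <= 1 -> 0 <= f s) -> 0 <= l.
Proof.
intros Hd H0 H. apply is_derive_Reals in Hd. apply Rnot_lt_le. intros Hl.
destruct (Hd (- l) ltac:(lra)) as [delta Hdelta].
pose proof (cond_pos delta) as Hp.
set (s := Rmin 1 (delta / 2)).
assert (Hs : 0 < s) by (apply Rmin_glb_lt; lra).
assert (Hs1 : s <= 1) by apply Rmin_l.
assert (Hs2 : s <= delta / 2) by apply Rmin_r.
specialize (Hdelta s ltac:(lra)). rewrite Rplus_0_l, H0, Rminus_0_r in Hdelta.
rewrite (Rabs_pos_eq s) in Hdelta by lra. specialize (Hdelta ltac:(lra)).
pose proof (H s ltac:(lra)). apply Rabs_lt_between in Hdelta.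
assert (0 <= f s / s) by (apply Rdiv_le_0_compat; lra). lra.
Qed.

(* [(p - c) / (p + conj c)] maps the disc of radius [|z0|] into the unit disc, has a zero
   of order [n] at [0], and modulus [1] at [z0]. *)
Lemma half_plane_boundary_derivative (p : C -> C) (c z0 p1 : C) (n : nat) :
  z0 <> RtoC 0 -> (0 < n)%nat -> 0 < fst c ->
  (forall z, Cmod z <= Cmod z0 -> exists a, jet p z a) ->
  (forall z, Cmod z <= Cmod z0 -> 0 <= fst (p z)) ->
  bigO n (fun h => p h - c)%C ->
  fst (p z0) = 0 -> jet p z0 p1 ->
  2 * fst c * fst (z0 * p1)%C <= - INR n * Cmod (c - p z0)%C ^ 2.
Proof.
intros Hz0 Hn Hc Hjet Hre HO Hb Hp1.
assert (Hrho : 0 < Cmod z0) by now apply Cmod_gt_0.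
assert (Hnz : forall z, Cmod z <= Cmod z0 -> (p z + Cconj c)%C <> RtoC 0).
{ intros z Hz E. apply (f_equal fst) in E. simpl in E. pose proof (Hre z Hz). lra. }
(* The squares differ by [4 Re p Re c]. *)
assert (Hle : forall z, Cmod z <= Cmod z0 -> Cmod (p z - c)%C <= Cmod (p z + Cconj c)%C).
{ intros z Hz. pose proof (Hre z Hz). unfold Cmod. apply sqrt_le_1_alt. simpl. nra. }
set (W := fun z => ((p z - c) * / (p z + Cconj c))%C).
assert (Hinv : forall z, Cmod z <= Cmod z0 -> exists a, jet (fun z => / (p z + Cconj c))%C z a).
{ intros z Hz. destruct (Hjet z Hz) as [a Ha]. eexists.
  eapply (jet_comp Cinv (fun z => p z + Cconj c)%C z); [now apply jet_inv, Hnz|].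
  apply jet_plus; [exact Ha | apply jet_const]. }
assert (HW : forall z, Cmod z <= Cmod z0 -> Cmod (W z) * Cmod z0 ^ n <= Cmod z ^ n).
{ intros z Hz. destruct (Ceq_dec z 0) as [->|Hzn].
  { destruct HO as (K & d & _ & Hd & H). unfold W. rewrite Cmod_mult.
    specialize (H 0). rewrite Cmod_0, pow_i in * by exact Hn.
    pose proof (Cmod_ge_0 (p 0 - c)%C). specialize (H Hd).
    replace (Cmod (p 0 - c)%C) with 0 by lra. lra. }
  apply (schwarz_order W (Cmod z0) n); auto.
  - intros w Hw. destruct (Hinv w Hw) as [a Ha]. destruct (Hjet w Hw) as [a' Ha'].
    eexists. eapply (jet_mult (fun z => p z - c)%C); [|exact Ha].
    eapply (jet_plus p (fun _ => - c)%C); [exact Ha' | apply jet_const].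
  - unfold W. replace n with (n + 0)%nat by lia. apply bigO_mult; [exact HO|].
    destruct (Hinv 0) as [a Ha]; [rewrite Cmod_0; lra|].
    apply bigO_ext with (fun h => (/ (p (0 + h) + Cconj c) - / (p 0 + Cconj c))
      + / (p 0 + Cconj c))%C.
    { intros h. replace (0 + h)%C with h by ring. ring. }
    apply bigO_plus; [|apply bigO_const].
    apply bigO_le with 1%nat; [lia|]. exact (jet_incr _ _ _ Ha).
  - intros w Hw. assert (Hw' : Cmod w <= Cmod z0) by lra.
    unfold W. rewrite Cmod_mult, Cmod_inv by now apply Hnz.
    assert (0 < Cmod (p w + Cconj c)%C) by (apply Cmod_gt_0; now apply Hnz).
    rewrite <- (Rinv_r (Cmod (p w + Cconj c)%C)) by lra.
    apply Rmult_le_compat_r; [left; now apply Rinv_0_lt_compat | now apply Hle]. }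
set (g := fun s : R => p (z0 + s * - z0)%C).
assert (Hg : is_Rderive g 0 (p1 * - z0)%C) by now apply jet_is_Rderive.
assert (Hg0 : g 0 = p z0) by (unfold g; f_equal; ring).
(* The Schwarz bound at [(1 - s) z0], squared and cleared of its denominator. It is an equality at
   [s = 0], so [phi] has a nonnegative derivative there, and this is twice the claim. *)
set (phi := fun s : R => ((1 - s) ^ n) ^ 2 * ((fst (g s) + fst c) ^ 2 + (snd (g s) - snd c) ^ 2)
  - ((fst (g s) - fst c) ^ 2 + (snd (g s) - snd c) ^ 2)).
assert (Hphi : forall s, 0 <= s <= 1 -> 0 <= phi s).
{ intros s Hs. set (w := (z0 + s * - z0)%C).
  assert (Hw : Cmod w = (1 - s) * Cmod z0).
  { replace w with ((1 - s)%R * z0)%C by (unfold w; rewrite RtoC_minus; ring).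
    rewrite Cmod_mult, Cmod_R, Rabs_pos_eq; lra. }
  assert (Hwz : Cmod w <= Cmod z0) by (rewrite Hw; nra).
  pose proof (HW w Hwz) as H. rewrite Hw, Rpow_mult_distr in H.
  apply Rmult_le_reg_r in H; [|now apply pow_lt].
  assert (HD : 0 < Cmod (p w + Cconj c)%C) by (apply Cmod_gt_0; now apply Hnz).
  unfold W in H. rewrite Cmod_mult, Cmod_inv in H by now apply Hnz.
  assert (H' : Cmod (p w - c)%C <= (1 - s) ^ n * Cmod (p w + Cconj c)%C).
  { apply Rmult_le_reg_r with (/ Cmod (p w + Cconj c)%C); [now apply Rinv_0_lt_compat|].
    rewrite Rmult_assoc, Rinv_r, Rmult_1_r by lra. exact H. }
  assert (H2 : Cmod (p w - c)%C ^ 2 <= ((1 - s) ^ n) ^ 2 * Cmod (p w + Cconj c)%C ^ 2).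
  { rewrite <- Rpow_mult_distr. apply pow_incr. split; [apply Cmod_ge_0 | exact H']. }
  rewrite !Cmod2_alt in H2. unfold phi. change (g s) with (p w).
  unfold Re, Im in H2. simpl in H2. simpl. lra. }
destruct Hg as [Hg1 Hg2].
(* Abstract [x] and [y] keep [auto_derive] from looking inside the components of [g]. *)
assert (Hd : forall (x y : R -> R) (x' y' : R), is_derive x 0 x' -> is_derive y 0 y' ->
  x 0 = 0 -> is_derive (fun s => ((1 - s) ^ n) ^ 2 * ((x s + fst c) ^ 2 + (y s - snd c) ^ 2)
    - ((x s - fst c) ^ 2 + (y s - snd c) ^ 2)) 0
    (- 2 * INR n * (fst c ^ 2 + (y 0 - snd c) ^ 2) + 4 * fst c * x')).
{ intros x y x' y' Hx Hy Hx0. auto_derive.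
  - repeat split; (eexists; eassumption).
  - replace (Derive (fun s : R => x s) 0) with x' by (symmetry; now apply is_derive_unique).
    replace (Derive (fun s : R => y s) 0) with y' by (symmetry; now apply is_derive_unique).
    rewrite Hx0.
    replace (1 + - 0) with 1 by ring. rewrite !pow1. simpl. ring. }
assert (Hx0 : fst (g 0) = 0) by now rewrite Hg0.
specialize (Hd _ _ _ _ Hg1 Hg2 Hx0). cbv beta in Hd.
change (is_derive phi 0 (- 2 * INR n * (fst c ^ 2 + (snd (g 0) - snd c) ^ 2)
  + 4 * fst c * fst (p1 * - z0)%C)) in Hd. rewrite Hg0 in Hd.
apply is_derive_right_nonneg in Hd; [|unfold phi; rewrite Hg0, Hb, Rminus_0_r, !pow1; ring
  |exact Hphi].
rewrite Cmod2_alt. unfold Re, Im. simpl. simpl in Hd. rewrite Hb.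
replace (- INR n) with (-1 * INR n) by ring. nra.
Qed.

(* The curve [z0 (1 + i s - s^2)] stays in the disc and is tangent to the circle. *)
Lemma half_plane_tangential_derivative (q : C -> C) (z0 q1 : C) (A B : R) :
  jet q z0 q1 ->
  (forall z, Cmod z <= Cmod z0 -> 0 <= A * fst (q z) + B * snd (q z)) ->
  A * fst (q z0) + B * snd (q z0) = 0 ->
  A * fst (q1 * (Ci * z0))%C + B * snd (q1 * (Ci * z0))%C = 0.
Proof.
intros Hq Hnn H0.
(* The two tangential directions, [e = 1] and [e = -1], give opposite inequalities. *)
assert (Hdir : forall e : R, e * e = 1 ->
  0 <= e * (A * fst (q1 * (Ci * z0))%C + B * snd (q1 * (Ci * z0))%C)).
{ intros e He.
  set (gam := fun w => (z0 + w * (e * (Ci * z0)) + w * w * - z0)%C).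
  assert (Hg0 : gam 0 = z0) by (unfold gam; ring).
  assert (Hgam : jet gam 0 (e * (Ci * z0))%C).
  { exists (- z0)%C. apply bigO_zero. intros h. unfold gam. ring. }
  assert (Hqg : jet (fun w => q (gam w)) 0 (q1 * (e * (Ci * z0)))%C).
  { apply jet_comp; [now rewrite Hg0 | exact Hgam]. }
  destruct (jet_is_Rderive _ _ _ 1 Hqg) as [D1 D2].
  replace (q1 * (e * (Ci * z0)) * 1)%C with (e * (q1 * (Ci * z0)))%C in D1, D2 by ring.
  apply (is_derive_right_nonneg
    (fun s => A * fst (q (gam (0 + s * 1)%C)) + B * snd (q (gam (0 + s * 1)%C)))).
  - replace (e * (A * fst (q1 * (Ci * z0))%C + B * snd (q1 * (Ci * z0))%C))
      with (A * fst (e * (q1 * (Ci * z0)))%C + B * snd (e * (q1 * (Ci * z0)))%C)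
      by (simpl; ring).
    exact (is_derive_plus (fun s : R => A * fst (q (gam (0 + s * 1)%C))) _ _ _ _
      (is_derive_scal _ _ A _ D1) (is_derive_scal _ _ B _ D2)).
  - replace (0 + 0 * 1)%C with (RtoC 0) by ring. rewrite Hg0. exact H0.
  - intros s Hs. apply Hnn.
    replace (gam (0 + s * 1)%C) with (((1 - s * s)%R, (e * s)%R) * z0)%C.
    + rewrite Cmod_mult. rewrite <- (Rmult_1_l (Cmod z0)) at 2.
      apply Rmult_le_compat_r; [apply Cmod_ge_0|].
      (* The squared modulus of the factor is [(1 - s^2)^2 + s^2 = 1 - s^2 + s^4]. *)
      apply Rle_trans with (sqrt 1); [|rewrite sqrt_1; lra].
      unfold Cmod. apply sqrt_le_1_alt. simpl.
      replace (e * s * (e * s * 1)) with (e * e * (s * s)) by ring. rewrite He.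
      assert (0 <= s * s <= 1) by nra.
      assert (s * s * (s * s) <= s * s * 1) by (apply Rmult_le_compat_l; lra). lra.
    + unfold gam. apply injective_projections; simpl; ring. }
pose proof (Hdir 1 ltac:(ring)). pose proof (Hdir (-1) ltac:(ring)). lra.
Qed.

(** * Estimate at a boundary point *)

Lemma Carg_right (w : C) : 0 < fst w -> Carg w = atan (snd w / fst w).
Proof.
intros Hw. pose proof (atan_bound (snd w / fst w)) as Hb. pose proof PI_RGT_0.
set (th := atan (snd w / fst w)) in *.
assert (Hc : 0 < cos th) by (apply cos_gt_0; lra).
assert (Ht : tan th = snd w / fst w) by apply tan_atan.
unfold tan in Ht.
assert (Hs : sin th = snd w / fst w * cos th) by (rewrite <- Ht; field; lra).
assert (Hp : w = polar (fst w / cos th) th).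
{ unfold polar. apply injective_projections; simpl; [field; lra|].
  rewrite Hs. field. lra. }
rewrite Hp. apply Carg_polar; [|lra]. now apply Rdiv_lt_0_compat.
Qed.

(** * Elementary inequalities and the minimising modulus *)

Lemma atan_le (v w : R) : v <= w -> atan v <= atan w.
Proof. intros [Hl| ->]; [left; now apply atan_increasing | right; reflexivity]. Qed.

Lemma ln_le_sub_1 (x : R) : 0 < x -> ln x <= x - 1.
Proof.
intros Hx. pose proof (exp_ineq1_le (ln x)) as H. rewrite exp_ln in H by exact Hx. lra.
Qed.

(** Concavity of [ln]: its tangent at the mean [m] of [u] and [1], with weights [a] and [1 - a],
    lies above both [ln u] and [ln 1]. *)
Lemma Rpower_le_bernoulli (u a : R) :
  0 < a < 1 -> 0 < u -> Rpower u a <= a * u + (1 - a).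
Proof.
intros Ha Hu. set (m := a * u + (1 - a)).
assert (Hm : 0 < m) by (unfold m; nra).
rewrite <- (exp_ln m) by exact Hm. unfold Rpower.
assert (Hle : a * ln u <= ln m).
{ assert (0 < / m) by now apply Rinv_0_lt_compat.
  pose proof (ln_le_sub_1 (u * / m) ltac:(now apply Rmult_lt_0_compat)) as H1.
  pose proof (ln_le_sub_1 (/ m) ltac:(assumption)) as H2.
  rewrite ln_mult, ln_Rinv in H1 by assumption. rewrite ln_Rinv in H2 by assumption.
  assert (Hz : a * (u * / m - 1) + (1 - a) * (/ m - 1) = 0)
    by (unfold m; field; unfold m in Hm; lra).
  nra. }
destruct Hle as [Hl|Hl]; [left; now apply exp_increasing | now rewrite Hl; right].
Qed.

Lemma Rpower_ge_bernoulli (u a : R) :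
  0 < a -> 0 < u -> 1 + a * (1 - / u) <= Rpower u a.
Proof.
intros Ha Hu. unfold Rpower. eapply Rle_trans; [|apply exp_ineq1_le].
assert (0 < / u) by now apply Rinv_0_lt_compat.
pose proof (ln_le_sub_1 (/ u) ltac:(assumption)) as HL. rewrite ln_Rinv in HL by exact Hu.
nra.
Qed.

(** The equation is [(1 - a) y^2 + 2 a y sin t - (1 + a) = 0] at [y = xi_plus a t], the critical
    point equation of [(1 - 2 y sin t + y^2) / y^(1 + a)]. It reduces [a (1 - 2 y sin t + y^2) / y]
    at this point to [xi - 1 / xi], the numerator in [Theta]. *)
Lemma xi_plus_spec (a t : R) : 0 < a < 1 -> 0 < cos t ->
  0 < xi_plus a t /\
  2 * a * sin t = (1 + a) / xi_plus a t - (1 - a) * xi_plus a t.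
Proof.
intros Ha Hc. pose proof (sin2_cos2 t) as H1. unfold Rsqr in H1.
assert (Hd : (a * sin t) ^ 2 < 1 - a ^ 2 * cos t ^ 2) by nra.
pose proof (pow2_ge_0 (a * sin t)).
set (D := sqrt (1 - a ^ 2 * cos t ^ 2)).
assert (HD2 : D * D = 1 - a ^ 2 * cos t ^ 2) by (apply sqrt_sqrt; lra).
assert (HD : 0 < D) by (apply sqrt_lt_R0; lra).
assert (Hpos : 0 < xi_plus a t).
{ apply Rdiv_lt_0_compat; [|lra]. fold D. simpl in Hd. nra. }
split; [exact Hpos|].
assert (Hq : (1 - a) * xi_plus a t = D - a * sin t)
  by (unfold xi_plus; fold D; field; lra).
apply Rmult_eq_reg_r with (xi_plus a t * (1 - a)); [|nra].
replace (((1 + a) / xi_plus a t - (1 - a) * xi_plus a t) * (xi_plus a t * (1 - a)))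
  with ((1 + a) * (1 - a) - ((1 - a) * xi_plus a t) * ((1 - a) * xi_plus a t))
  by (field; lra).
replace (2 * a * sin t * (xi_plus a t * (1 - a)))
  with (2 * a * sin t * ((1 - a) * xi_plus a t)) by ring.
rewrite Hq. nra.
Qed.

(* [xi_plus] minimises [(1 - 2 y sin t + y^2) / y^(1+a)]; the inequality is the sum of
   two Bernoulli inequalities for [u = y / xi_plus], with weights [xi] and [1 / xi]. *)
Lemma xi_plus_minimal (a t y : R) : 0 < a < 1 -> 0 < cos t -> 0 < y ->
  (xi_plus a t - / xi_plus a t) * Rpower (y / xi_plus a t) a
  <= a * (1 - 2 * y * sin t + y ^ 2) / y.
Proof.
intros Ha Hc Hy. destruct (xi_plus_spec a t Ha Hc) as [Hx Heq].
set (x := xi_plus a t) in *. set (u := y / x).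
assert (Hu : 0 < u) by now apply Rdiv_lt_0_compat.
assert (Hyu : y = u * x) by (unfold u; field; lra).
pose proof (Rpower_le_bernoulli u a Ha Hu) as B1.
pose proof (Rpower_ge_bernoulli u a ltac:(lra) Hu) as B2.
replace (a * (1 - 2 * y * sin t + y ^ 2) / y)
  with (a / y + a * y - 2 * a * sin t) by (field; lra).
rewrite Heq, Hyu.
replace (a / (u * x) + a * (u * x) - ((1 + a) / x - (1 - a) * x))
  with (x * (a * u + (1 - a)) - / x * (1 + a * (1 - / u))) by (field; lra).
assert (0 < / x) by now apply Rinv_0_lt_compat.
set (P := Rpower u a) in *.
assert (x * P <= x * (a * u + (1 - a))) by (apply Rmult_le_compat_l; lra).
assert (/ x * (1 + a * (1 - / u)) <= / x * P) by (apply Rmult_le_compat_l; lra).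
lra.
Qed.

(** The hypothesis on [Q] is the half-plane estimate for [c = polar r t] and [p(z0) = i x]: the
    bracket is [|c - i x|^2], and [x Q / a] is [- Re (z0 p'(z0))]. With [y = x / r] it reduces to
    [xi_plus_minimal]. *)
Lemma Theta_le_atan (a r t x Q : R) (n : nat) :
  0 < a < 1 -> 0 < r -> 0 < cos t -> 0 < x ->
  INR n * (r ^ 2 - 2 * r * x * sin t + x ^ 2) <= 2 * r * cos t * (x * Q / a) ->
  Theta n a r t (xi_plus a t)
  <= atan (tan (PI * a / 2) + Q / (Rpower x a * cos (PI * a / 2))).
Proof.
intros Ha Hr Hc Hx H.
unfold Theta. apply atan_le, Rplus_le_compat_l.
pose proof PI_RGT_0.
assert (Hcb : 0 < cos (PI * a / 2)) by (apply cos_gt_0; nra).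
set (cb := cos (PI * a / 2)) in *.
destruct (xi_plus_spec a t Ha Hc) as [Hxi _].
set (y := x / r). assert (Hy : 0 < y) by now apply Rdiv_lt_0_compat.
pose proof (xi_plus_minimal a t y Ha Hc Hy) as Hmin.
set (xi := xi_plus a t) in *.
assert (Hpow : Rpower x a = Rpower r a * Rpower xi a * Rpower (y / xi) a).
{ assert (0 < y / xi) by now apply Rdiv_lt_0_compat.
  assert (0 < r * xi) by now apply Rmult_lt_0_compat.
  rewrite !Rpower_mult_distr by assumption. f_equal. unfold y. field. lra. }
set (P := Rpower (y / xi) a) in *.
assert (HP : 0 < P) by apply exp_pos.
set (M := Rpower r a * Rpower xi a) in *.
assert (HM : 0 < M) by (apply Rmult_lt_0_compat; apply exp_pos).
rewrite Hpow.
replace (INR n * (xi - / xi) / (2 * Rpower r a * Rpower xi a * cb * cos t))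
  with (INR n * ((xi - / xi) * P) / (2 * cos t) * / (M * P * cb)).
2:{ unfold M. field. repeat split; try lra; apply Rgt_not_eq, exp_pos. }
unfold Rdiv at 2. apply Rmult_le_compat_r.
{ left. apply Rinv_0_lt_compat, Rmult_lt_0_compat; [now apply Rmult_lt_0_compat | exact Hcb]. }
apply Rmult_le_reg_r with (2 * cos t); [lra|].
unfold Rdiv. rewrite Rmult_assoc, Rinv_l, Rmult_1_r by lra.
apply Rle_trans with (INR n * (a * (1 - 2 * y * sin t + y ^ 2) / y)).
{ apply Rmult_le_compat_l; [apply pos_INR | exact Hmin]. }
apply Rmult_le_reg_r with (r * x / a); [apply Rdiv_lt_0_compat; nra|].
replace (INR n * (a * (1 - 2 * y * sin t + y ^ 2) / y) * (r * x / a))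
  with (INR n * (r ^ 2 - 2 * r * x * sin t + x ^ 2)) by (unfold y; field; lra).
replace (Q * (2 * cos t) * (r * x / a)) with (2 * r * cos t * (x * Q / a)) by (field; lra).
exact H.
Qed.

Lemma sector_polar (w : C) (beta e : R) :
  0 < fst w -> - (PI / 2) < beta < PI / 2 -> e * e = 1 ->
  e * snd w * cos beta = fst w * sin beta ->
  Clog w = (ln (Cmod w), e * beta) /\ w = polar (Cmod w) (e * beta).
Proof.
intros Hw Hb He H.
assert (Hcb : 0 < cos beta) by (apply cos_gt_0; lra).
assert (Hx : snd w / fst w = e * tan beta).
{ unfold tan. apply Rmult_eq_reg_r with (fst w * cos beta); [|nra].
  replace (snd w / fst w * (fst w * cos beta)) with (1 * (snd w * cos beta)) by (field; lra).
  rewrite <- He. replace (e * (sin beta / cos beta) * (fst w * cos beta))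
    with (e * (fst w * sin beta)) by (field; lra). rewrite <- H. ring. }
assert (Ha : atan (snd w / fst w) = e * beta).
{ rewrite Hx. assert (e = 1 \/ e = -1) as [->| ->].
  { assert ((e - 1) * (e + 1) = 0) as [E|E]%Rmult_integral by lra; lra. }
  - rewrite !Rmult_1_l. apply atan_tan. lra.
  - replace (-1 * tan beta) with (- tan beta) by ring. rewrite atan_opp, atan_tan; lra. }
split.
- unfold Clog. now rewrite Ha.
- rewrite <- Ha, <- Carg_right by exact Hw. symmetry. apply polar_Carg.
  intros E. rewrite E in Hw. simpl in Hw. lra.
Qed.

(* [e = 1] and [e = -1] stand for the upper and the lower boundary ray of the sector;
   reflection replaces [t] by [- t] and turns [xi_minus] into [xi_plus]. *)
Lemma boundary_ray_estimate (a r t : R) (n : nat) (q : C -> C) (z0 q1 : C) (e : R) :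
  let beta := PI * a / 2 in
  let Q := (z0 * q1 / q z0)%C in
  0 < a < 1 -> 0 < r -> 0 < cos t -> (0 < n)%nat -> z0 <> RtoC 0 -> e * e = 1 ->
  (forall z, Cmod z <= Cmod z0 -> exists a, jet q z a) ->
  (forall z, Cmod z <= Cmod z0 ->
     0 < fst (q z) /\ Rabs (snd (q z)) * cos beta <= fst (q z) * sin beta) ->
  bigO n (fun h => q h - polar (Rpower r a) (a * t))%C ->
  - (PI / 2) < t < PI / 2 ->
  jet q z0 q1 -> e * snd (q z0) * cos beta = fst (q z0) * sin beta ->
  Theta n a r (e * t) (xi_plus a (e * t)) <= e * Carg (q z0 + Q)%C.
Proof.
intros beta Q Ha Hr Hct Hn Hz0 He Hjet Hsec HO Ht Hq1 Hbd.
pose proof PI_RGT_0 as HPI.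
assert (Hbeta : 0 < beta < PI / 2) by (unfold beta; nra).
assert (Hcb : 0 < cos beta) by (apply cos_gt_0; lra).
assert (Hsb : 0 < sin beta) by (apply sin_gt_0; lra).
assert (He1 : e = 1 \/ e = -1).
{ assert ((e - 1) * (e + 1) = 0) as [E|E]%Rmult_integral by lra; lra. }
assert (Hz0le : Cmod z0 <= Cmod z0) by lra.
destruct (Hsec z0 Hz0le) as [Hw0 _].
assert (Hbr : - (PI / 2) < beta < PI / 2) by lra.
destruct (sector_polar (q z0) beta e Hw0 Hbr He Hbd) as [Hlog Hpol].
assert (Hqn : q z0 <> RtoC 0) by (intros E; rewrite E in Hw0; simpl in Hw0; lra).
assert (HR : 0 < Cmod (q z0)) by now apply Cmod_gt_0.
set (R0 := Cmod (q z0)) in *.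
assert (Hcos : cos (e * beta) = cos beta).
{ destruct He1 as [->| ->]; [f_equal; ring|]. rewrite <- (cos_neg beta). f_equal; ring. }
assert (Hsin : sin (e * beta) = e * sin beta).
{ destruct He1 as [->| ->]; [rewrite !Rmult_1_l; reflexivity|].
  replace (-1 * sin beta) with (- sin beta) by ring. rewrite <- sin_neg. f_equal; ring. }
assert (Hcost : cos (e * t) = cos t).
{ destruct He1 as [->| ->]; [f_equal; ring|]. rewrite <- (cos_neg t). f_equal; ring. }
assert (Hsint : sin (e * t) = e * sin t).
{ destruct He1 as [->| ->]; [rewrite !Rmult_1_l; reflexivity|].
  replace (-1 * sin t) with (- sin t) by ring. rewrite <- sin_neg. f_equal; ring. }
assert (Hq0 : q z0 = (R0 * cos beta, R0 * (e * sin beta))).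
{ rewrite Hpol. unfold polar. now rewrite Hcos, Hsin. }
assert (HQ : (z0 * q1)%C = (Q * q z0)%C) by (unfold Q; field; exact Hqn).
clearbody Q.
(* The sector lies on one side of the line through the ray, so the tangential derivative [i Q q(z0)]
   is parallel to that line, that is, to [q(z0)]; hence [i Q] is real. *)
assert (HQ1 : fst Q = 0).
{ pose proof (half_plane_tangential_derivative q z0 q1 (sin beta) (- (e * cos beta)) Hq1) as T.
  replace (q1 * (Ci * z0))%C with (Ci * (Q * q z0))%C in T by (rewrite <- HQ; ring).
  assert (Hnn : forall z, Cmod z <= Cmod z0 ->
    0 <= sin beta * fst (q z) + - (e * cos beta) * snd (q z)).
  { intros z Hz. destruct (Hsec z Hz) as [_ Hs].
    assert (e * snd (q z) <= Rabs (snd (q z))).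
    { destruct He1 as [->| ->]; [rewrite Rmult_1_l; apply Rle_abs|].
      rewrite <- Rabs_Ropp. eapply Rle_trans; [|apply Rle_abs]. lra. }
    assert (e * snd (q z) * cos beta <= Rabs (snd (q z)) * cos beta)
      by (apply Rmult_le_compat_r; lra). lra. }
  specialize (T Hnn ltac:(lra)). rewrite Hq0 in T. simpl in T.
  pose proof (sin2_cos2 beta) as S. unfold Rsqr in S.
  assert (E : e * R0 * fst Q * (sin beta * sin beta + cos beta * cos beta) = 0).
  { clear - T He1. destruct He1 as [->| ->]; lra. }
  rewrite S, Rmult_1_r in E.
  apply Rmult_integral in E as [E|E]; [|exact E].
  apply Rmult_integral in E as [E|E]; [|lra]. rewrite E in He. lra. }
set (p := fun z => Cexp (RtoC (/ a) * Clog (q z))%C).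
set (x := exp (/ a * ln R0)).
assert (Hx : 0 < x) by apply exp_pos.
(* The angle [e beta] divided by [a] is [e PI / 2]. *)
assert (Hp0 : p z0 = (0, e * x)).
{ unfold p. rewrite Hlog. unfold Cexp, polar. simpl.
  replace (/ a * ln R0 - 0 * (e * beta)) with (/ a * ln R0) by ring.
  replace (/ a * (e * beta) + 0 * ln R0) with (e * (PI / 2)) by (unfold beta; field; lra).
  fold x. destruct He1 as [->| ->].
  - rewrite Rmult_1_l, cos_PI2, sin_PI2. f_equal; ring.
  - replace (-1 * (PI / 2)) with (- (PI / 2)) by ring.
    rewrite cos_neg, sin_neg, cos_PI2, sin_PI2. f_equal; ring. }
assert (HjF : forall w, 0 < fst w ->
  jet (fun w => Cexp (RtoC (/ a) * Clog w)%C) w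
    (Cexp (RtoC (/ a) * Clog w)%C * (0 * Clog w + RtoC (/ a) * / w))%C).
{ intros w Hw. apply (jet_comp Cexp (fun w => RtoC (/ a) * Clog w)%C); [apply jet_Cexp|].
  apply (jet_mult (fun _ => RtoC (/ a)) Clog); [apply jet_const | now apply jet_Clog]. }
assert (Hjp : forall z b, 0 < fst (q z) -> jet q z b ->
  jet p z (p z * (0 * Clog (q z) + RtoC (/ a) * / q z) * b)%C).
{ intros z b Hz Hb. apply (jet_comp (fun w => Cexp (RtoC (/ a) * Clog w)%C) q);
    [now apply HjF | exact Hb]. }
set (p1 := (p z0 * (0 * Clog (q z0) + RtoC (/ a) * / q z0) * q1)%C).
pose proof (half_plane_boundary_derivative p (polar r t) z0 p1 n Hz0 Hn) as HB.
assert (HBc : 0 < fst (polar r t)) by (simpl; nra).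
assert (HBre : forall z, Cmod z <= Cmod z0 -> 0 <= fst (p z)).
{ intros z Hz. destruct (Hsec z Hz) as [Hf Hs]. unfold p, Cexp, polar, Clog. simpl.
  apply Rmult_le_pos; [left; apply exp_pos|].
  set (v := snd (q z) / fst (q z)).
  assert (Hv : - tan beta <= v <= tan beta).
  { apply Rabs_le_between. unfold v, tan, Rdiv. rewrite Rabs_mult.
    rewrite (Rabs_pos_eq (/ fst (q z))) by (left; now apply Rinv_0_lt_compat).
    apply Rmult_le_reg_r with (fst (q z) * cos beta); [nra|].
    replace (Rabs (snd (q z)) * / fst (q z) * (fst (q z) * cos beta))
      with (Rabs (snd (q z)) * cos beta) by (field; lra).
    replace (sin beta * / cos beta * (fst (q z) * cos beta))
      with (fst (q z) * sin beta) by (field; lra). exact Hs. }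
  assert (Hat : - beta <= atan v <= beta).
  { rewrite <- (atan_tan beta) by lra. rewrite <- atan_opp. split; apply atan_le; lra. }
  assert (Hab : / a * beta = PI / 2) by (unfold beta; field; lra).
  assert (Hia : 0 < / a) by (apply Rinv_0_lt_compat; lra).
  apply cos_ge_0; nra. }
(* The power [1 / a] undoes the power [a] at [q0] because [a t] lies in the range of [atan]; its
   increment is [O(w - q0)], so it preserves the order [n]. *)
assert (HBO : bigO n (fun h => p h - polar r t)%C).
{ set (q0 := polar (Rpower r a) (a * t)) in *.
  assert (Hat : - (PI / 2) < a * t < PI / 2) by nra.
  assert (Hcat : 0 < cos (a * t)) by (apply cos_gt_0; lra).
  assert (HRp : 0 < Rpower r a) by apply exp_pos.
  assert (Hq0f : 0 < fst q0) by (simpl; now apply Rmult_lt_0_compat).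
  assert (HF0 : Cexp (RtoC (/ a) * Clog q0)%C = polar r t).
  { assert (HC : Clog q0 = (ln (Rpower r a), a * t)).
    { unfold Clog, q0. rewrite Cmod_polar by exact HRp. f_equal. simpl.
      rewrite <- (atan_tan (a * t)) at 3 by lra. f_equal. unfold tan. field. lra. }
    rewrite HC. unfold Rpower. rewrite ln_exp. unfold Cexp, polar. simpl.
    replace (/ a * (a * ln r) - 0 * (a * t)) with (ln r) by (field; lra).
    replace (/ a * (a * t) + 0 * (a * ln r)) with t by (field; lra).
    now rewrite exp_ln. }
  pose proof (bigO_comp 1 n _ _ Hn (jet_incr _ _ _ (HjF q0 Hq0f)) HO) as Hc.
  rewrite Nat.mul_1_r in Hc. eapply bigO_ext; [|exact Hc].
  intros h. simpl. rewrite HF0. unfold p.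
  replace (q0 + (q h - q0))%C with (q h) by ring. reflexivity. }
specialize (HB HBc).
assert (HBjet : forall z, Cmod z <= Cmod z0 -> exists a, jet p z a).
{ intros z Hz. destruct (Hjet z Hz) as [b Hb]. eexists.
  apply (Hjp z b); [apply (Hsec z Hz) | exact Hb]. }
specialize (HB HBjet HBre HBO).
rewrite Hp0 in HB. specialize (HB eq_refl (Hjp z0 q1 Hw0 Hq1)).
(* Logarithmic differentiation: [z0 p1 = p(z0) Q / a], where [p(z0) = i e x]. *)
assert (Hzp1 : fst (z0 * p1)%C = - (x * (e * snd Q) / a)).
{ unfold p1. rewrite Hp0.
  replace (z0 * ((0, (e * x)%R) * (0 * Clog (q z0) + RtoC (/ a) * / q z0) * q1))%C
    with ((0, (e * x)%R) * (0 * Clog (q z0) + RtoC (/ a) * / q z0) * (z0 * q1))%C by ring.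
  rewrite HQ.
  replace ((0, (e * x)%R) * (0 * Clog (q z0) + RtoC (/ a) * / q z0) * (Q * q z0))%C
    with ((0, (e * x)%R) * RtoC (/ a) * Q)%C by (field; exact Hqn).
  simpl. field. lra. }
rewrite Hzp1, Cmod2_alt in HB.
assert (HB' : INR n * (r ^ 2 - 2 * r * x * sin (e * t) + x ^ 2)
  <= 2 * r * cos (e * t) * (x * (e * snd Q) / a)).
{ rewrite Hcost, Hsint. unfold Re, Im in HB. simpl in HB.
  replace (r ^ 2 - 2 * r * x * (e * sin t) + x ^ 2)
    with (r ^ 2 * (sin t * sin t + cos t * cos t) - 2 * r * x * (e * sin t) + e * e * x ^ 2).
  2:{ pose proof (sin2_cos2 t) as S. unfold Rsqr in S. rewrite S, He. ring. }
  assert (HBn : - INR n * ((r * cos t + - 0) * ((r * cos t + - 0) * 1)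
     + (r * sin t + - (e * x)) * ((r * sin t + - (e * x)) * 1)) =
     - (INR n * (r ^ 2 * (sin t * sin t + cos t * cos t)
        - 2 * r * x * (e * sin t) + e * e * x ^ 2)))
    by ring.
  rewrite HBn in HB. lra. }
pose proof (Theta_le_atan a r (e * t) x (e * snd Q) n Ha Hr ltac:(now rewrite Hcost) Hx HB') as HT.
eapply Rle_trans; [exact HT|]. fold beta.
assert (HRx : Rpower x a = R0).
{ unfold Rpower, x. rewrite ln_exp. replace (a * (/ a * ln R0)) with (ln R0) by (field; lra).
  now apply exp_ln. }
rewrite HRx, Carg_right by (rewrite Hq0; simpl; rewrite HQ1; nra).
rewrite Hq0. simpl. rewrite HQ1, Rplus_0_r.
replace (tan beta + e * snd Q / (R0 * cos beta))
  with (e * ((R0 * (e * sin beta) + snd Q) / (R0 * cos beta))).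
2:{ unfold tan. replace (sin beta / cos beta) with (e * e * (sin beta / cos beta))
      by (rewrite He; ring). field. lra. }
set (v := (R0 * (e * sin beta) + snd Q) / (R0 * cos beta)). clearbody v.
right. destruct He1 as [->| ->]; [now rewrite !Rmult_1_l|].
replace (-1 * v) with (- v) by ring. rewrite atan_opp. ring.
Qed.

(** * First exit from the sector *)

(** A point of least modulus in the compact set where [g <= 0], found by maximising [- |z|].
    Strictly inside its circle [g] is positive; on the circle nonnegativity follows by continuity
    along radii. *)
Lemma first_zero_on_disc (g : C -> R) (z1 : C) :
  (forall p eps, Cmod p <= Cmod z1 -> 0 < eps ->
     exists d, 0 < d /\ forall w, Cmod (w - p)%C < d -> Rabs (g w - g p) < eps) ->
  0 < g 0 -> g z1 <= 0 ->
  exists z0, z0 <> RtoC 0 /\ Cmod z0 <= Cmod z1 /\ g z0 = 0 /\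
    forall z, Cmod z <= Cmod z0 -> 0 <= g z.
Proof.
intros Hc H0 H1.
destruct (usc_max (fun z => Cmod z <= Cmod z1 /\ g z <= 0) (fun z => - Cmod z) (Cmod z1) z1)
  as [z0 [[Hz0 Hg0] Hmin]].
- split; [lra|exact H1].
- tauto.
- intros p Hp. destruct (Rle_dec (Cmod p) (Cmod z1)) as [Hle|Hgt].
  + assert (Hgp : 0 < g p) by (apply Rnot_le_lt; intros E; apply Hp; now split).
    destruct (Hc p (g p) Hle Hgp) as [d [Hd H]]. exists d. split; [exact Hd|].
    intros w Hw [_ Hgw]. specialize (H w Hw). apply Rabs_lt_between in H. lra.
  + exists (Cmod p - Cmod z1). split; [lra|]. intros w Hw [Hw1 _].
    pose proof (Cmod_ge_sub p (w - p)) as Ht.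
    replace (p + (w - p))%C with w in Ht by ring. lra.
- intros p v _ Hv. exists (v + Cmod p). split; [lra|]. intros w _ Hw.
  pose proof (Cmod_ge_sub p (w - p)) as Ht.
  replace (p + (w - p))%C with w in Ht by ring. lra.
- assert (Hz0n : z0 <> RtoC 0) by (intros ->; lra).
  assert (Hrho : 0 < Cmod z0) by now apply Cmod_gt_0.
  assert (Hin : forall z, Cmod z < Cmod z0 -> 0 < g z).
  { intros z Hz. apply Rnot_le_lt. intros E.
    assert (Hzz : Cmod z <= Cmod z1) by lra. specialize (Hmin z (conj Hzz E)). lra. }
  assert (Hnn : forall z, Cmod z <= Cmod z0 -> 0 <= g z).
  { intros z [Hz|Hz]; [left; now apply Hin|]. apply Rnot_lt_le. intros E.
    assert (Hzz : Cmod z <= Cmod z1) by lra.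
    destruct (Hc z (- g z) Hzz ltac:(lra)) as [d [Hd H]].
    set (s := Rmin (/ 2) (d / 2 / Cmod z0)).
    assert (Hs : 0 < s).
    { apply Rmin_glb_lt; [lra|]. apply Rdiv_lt_0_compat; lra. }
    assert (Hs1 : s <= / 2) by apply Rmin_l.
    assert (Hs2 : s * Cmod z0 <= d / 2).
    { replace (d / 2) with (d / 2 / Cmod z0 * Cmod z0) by (field; lra).
      apply Rmult_le_compat_r; [lra | apply Rmin_r]. }
    set (w := ((1 - s)%R * z)%C).
    assert (Hw : Cmod w < Cmod z0).
    { unfold w. rewrite Cmod_mult, Cmod_R, Rabs_pos_eq, Hz by lra. nra. }
    pose proof (Hin w Hw) as Hgw.
    assert (Hwz : Cmod (w - z)%C < d).
    { replace (w - z)%C with ((- s)%R * z)%C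
        by (unfold w; rewrite RtoC_opp, RtoC_minus; ring).
      rewrite Cmod_mult, Cmod_R, Rabs_Ropp, Rabs_pos_eq, Hz by lra. lra. }
    specialize (H w Hwz). apply Rabs_lt_between in H. lra. }
  exists z0. repeat split; auto. apply Rle_antisym; [exact Hg0 | apply Hnn; lra].
Qed.

(** For [w = R e^(i th)] with [|th| <= PI] this is [R sin (beta - |th|)]. Its sign tests membership
    in the sector, and unlike [Carg] it is continuous everywhere. *)
Definition sector_gap (beta : R) (w : C) : R := fst w * sin beta - Rabs (snd w) * cos beta.

Lemma sector_gap_lipschitz (beta : R) (v w : C) :
  Rabs (sector_gap beta v - sector_gap beta w) <= 2 * Cmod (v - w)%C.
Proof.
pose proof (re_le_Cmod (v - w)) as H1. unfold Re in H1. simpl in H1.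
assert (H2 : Rabs (snd v + - snd w) <= Cmod (v - w)%C).
{ eapply Rle_trans; [|apply Rmax_Cmod]. apply Rmax_r. }
pose proof (Rabs_triang_inv2 (snd v) (snd w)) as H3.
pose proof (SIN_bound beta). pose proof (COS_bound beta).
assert (Hs : Rabs (sin beta) <= 1) by now apply Rabs_le.
assert (Hc : Rabs (cos beta) <= 1) by now apply Rabs_le.
unfold sector_gap.
replace (fst v * sin beta - Rabs (snd v) * cos beta - (fst w * sin beta - Rabs (snd w) * cos beta))
  with ((fst v + - fst w) * sin beta - (Rabs (snd v) - Rabs (snd w)) * cos beta) by ring.
unfold Rminus at 1. eapply Rle_trans; [apply Rabs_triang|].
rewrite Rabs_Ropp, !Rabs_mult. unfold Rminus in *.
pose proof (Rabs_pos (fst v + - fst w)). pose proof (Rabs_pos (sin beta)).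
pose proof (Rabs_pos (cos beta)). pose proof (Rabs_pos (Rabs (snd v) + - Rabs (snd w))).
pose proof (Cmod_ge_0 (v - w)%C).
assert (Rabs (fst v + - fst w) * Rabs (sin beta) <= Cmod (v - w)%C * 1)
  by (apply Rmult_le_compat; lra).
assert (Rabs (Rabs (snd v) + - Rabs (snd w)) * Rabs (cos beta) <= Cmod (v - w)%C * 1)
  by (apply Rmult_le_compat; lra).
lra.
Qed.

Lemma sector_gap_polar (beta R0 th : R) :
  0 < R0 -> 0 < beta < PI / 2 -> Rabs th < beta -> 0 < sector_gap beta (polar R0 th).
Proof.
intros HR Hb Hth. unfold sector_gap, polar. simpl. rewrite Rabs_mult, (Rabs_pos_eq R0) by lra.
assert (Hs : Rabs (sin th) = sin (Rabs th)).
{ destruct (Rle_dec 0 th).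
  - rewrite (Rabs_pos_eq th) in * by lra. apply Rabs_pos_eq, sin_ge_0; lra.
  - rewrite (Rabs_left th) in * by lra. rewrite <- (Rabs_Ropp (sin th)), <- sin_neg.
    apply Rabs_pos_eq, sin_ge_0; lra. }
assert (Hc : cos th = cos (Rabs th)).
{ unfold Rabs. destruct (Rcase_abs th); [now rewrite cos_neg | reflexivity]. }
rewrite Hs, Hc. pose proof (Rabs_pos th).
replace (R0 * cos (Rabs th) * sin beta - R0 * sin (Rabs th) * cos beta)
  with (R0 * sin (beta - Rabs th)) by (rewrite sin_minus; ring).
apply Rmult_lt_0_compat; [exact HR|]. apply sin_gt_0; lra.
Qed.

(** The closed sector meets the imaginary axis only at its vertex. *)
Lemma sector_gap_right (beta : R) (w : C) :
  0 < beta < PI / 2 -> w <> RtoC 0 -> 0 <= sector_gap beta w -> 0 < fst w.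
Proof.
intros Hb Hw Hg. unfold sector_gap in Hg.
assert (Hcb : 0 < cos beta) by (apply cos_gt_0; lra).
assert (Hsb : 0 < sin beta) by (apply sin_gt_0; lra).
pose proof (Rabs_pos (snd w)).
assert (0 <= Rabs (snd w) * cos beta) by (apply Rmult_le_pos; lra).
assert (Hf : 0 <= fst w) by (apply Rmult_le_reg_r with (sin beta); lra).
destruct Hf as [Hf|Hf]; [exact Hf|exfalso]. apply Hw.
assert (Hz : Rabs (snd w) * cos beta = 0) by (rewrite <- Hf in Hg; lra).
apply Rmult_integral in Hz as [Hz|Hz]; [|lra].
apply injective_projections; simpl; [now symmetry|].
destruct (Req_dec (snd w) 0) as [E|E]; [exact E|]. now apply Rabs_no_R0 in E.
Qed.

Lemma sector_gap_Carg (beta : R) (w : C) :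
  0 < beta < PI / 2 -> w <> RtoC 0 -> 0 < sector_gap beta w -> Rabs (Carg w) < beta.
Proof.
intros Hb Hw Hg.
assert (Hf : 0 < fst w) by (apply (sector_gap_right beta); auto; lra).
unfold sector_gap in Hg.
assert (Hcb : 0 < cos beta) by (apply cos_gt_0; lra).
rewrite Carg_right by exact Hf.
assert (Hv : - tan beta < snd w / fst w < tan beta).
{ apply Rabs_lt_between. unfold tan, Rdiv. rewrite Rabs_mult.
  rewrite (Rabs_pos_eq (/ fst w)) by (left; now apply Rinv_0_lt_compat).
  apply Rmult_lt_reg_r with (fst w * cos beta); [nra|].
  replace (Rabs (snd w) * / fst w * (fst w * cos beta))
    with (Rabs (snd w) * cos beta) by (field; lra).
  replace (sin beta * / cos beta * (fst w * cos beta))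
    with (fst w * sin beta) by (field; lra). lra. }
apply Rabs_lt_between. rewrite <- (atan_tan beta) by lra. rewrite <- atan_opp.
split; now apply atan_increasing.
Qed.

Theorem corollary3p5 (alpha r t : R) (c : C) (n : nat) (q : C -> C)
  (Halpha : 0 < alpha < 1)
  (Hr : 0 < r)
  (Ht : - (PI / 2) < t < PI / 2)
  (Hc : c = polar r t)
  (Hn : (0 < n)%nat)
  (Hq : Hclass (Cpowr c alpha) n q)
  (Hcond : forall z : C, Cmod z < 1 ->
     q z <> RtoC 0 /\
     (q z + z * C_derive q z / q z)%C <> RtoC 0 /\
     - Theta_minus n alpha r t
       < Carg (q z + z * C_derive q z / q z)%C
       < Theta_plus n alpha r t) :
  forall z : C, Cmod z < 1 ->
    q z <> RtoC 0 /\ Rabs (Carg (q z)) < PI * alpha / 2.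
Proof.
intros z1 Hz1. destruct (Hcond z1 Hz1) as [Hq1 _]. split; [exact Hq1|].
pose proof PI_RGT_0 as HPI.
set (beta := PI * alpha / 2).
assert (Hbeta : 0 < beta < PI / 2) by (unfold beta; nra).
apply sector_gap_Carg; [exact Hbeta | exact Hq1 |].
destruct Hq as [_ (b & Hb0 & Hbk & Hbs)].
assert (Hser : forall z, Cmod z < 1 -> Cseries (fun k => Cpow z k * b k)%C (q z))
  by (intros z Hz; now apply pseries_Cseries, Hbs).
assert (HC : Cpowr c alpha = polar (Rpower r alpha) (alpha * t)).
{ rewrite Hc. unfold Cpowr. rewrite Cmod_polar, Carg_polar by lra. reflexivity. }
rewrite HC in Hb0.
assert (HO : bigO n (fun h => q h - polar (Rpower r alpha) (alpha * t))%C).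
{ rewrite <- Hb0. now apply pseries_vanishing_order. }
assert (Hq00 : q 0 = polar (Rpower r alpha) (alpha * t)).
{ destruct HO as (K & d & _ & Hd & H). specialize (H 0).
  rewrite Cmod_0, pow_i in H by exact Hn. specialize (H Hd).
  set (q0 := polar (Rpower r alpha) (alpha * t)) in *.
  assert (E : (q 0 - q0)%C = RtoC 0)
    by (apply Cmod_eq_0; pose proof (Cmod_ge_0 (q 0 - q0)%C); lra).
  replace (q 0) with (q 0 - q0 + q0)%C by ring. rewrite E. ring. }
assert (Hjet : forall z, Cmod z < 1 -> exists a, jet q z a)
  by (intros z Hz; now apply (pseries_jet b)).
apply Rnot_le_lt. intros Hexit.
destruct (first_zero_on_disc (fun z => sector_gap beta (q z)) z1)
  as (z0 & Hz0n & Hz0 & Hg0 & Hnn).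
- intros p eps Hp Heps. destruct (Hjet p ltac:(lra)) as [a Ha].
  destruct (jet_continuous q p a (eps / 2) Ha ltac:(lra)) as [d [Hd H]].
  exists d. split; [exact Hd|]. intros w Hw. specialize (H w Hw).
  cbv beta. pose proof (sector_gap_lipschitz beta (q w) (q p)). lra.
(* The centre value has argument [alpha t], inside the sector because [|t| < PI / 2]. *)
- cbv beta. rewrite Hq00. apply sector_gap_polar; [apply exp_pos | exact Hbeta |].
  rewrite Rabs_mult, (Rabs_pos_eq alpha) by lra.
  assert (Rabs t < PI / 2) by (apply Rabs_lt_between; lra). unfold beta. nra.
- exact Hexit.
- assert (Hz01 : Cmod z0 < 1) by lra.
  destruct (Hjet z0 Hz01) as [q1 Hjq].
  destruct (Hcond z0 Hz01) as (_ & _ & Hlo & Hhi).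
  rewrite (is_C_derive_unique q z0 q1 (jet_is_derive q z0 q1 Hjq)) in Hlo, Hhi.
  assert (Hct : 0 < cos t) by (apply cos_gt_0; lra).
  assert (Hsec : forall z, Cmod z <= Cmod z0 ->
    0 < fst (q z) /\ Rabs (snd (q z)) * cos beta <= fst (q z) * sin beta).
  { intros z Hz. pose proof (Hnn z Hz) as Hg. split.
    - apply (sector_gap_right beta); auto. apply Hcond. lra.
    - unfold sector_gap in Hg. lra. }
  assert (Hjet0 : forall z, Cmod z <= Cmod z0 -> exists a, jet q z a)
    by (intros z Hz; apply Hjet; lra).
  (* Here [e] is the sign of [Im q(z0)], which tells the ray that is hit; each sign contradicts one
     of the two bounds in [Hcond]. *)
  assert (Hest : forall e, e * e = 1 -> e * snd (q z0) = Rabs (snd (q z0)) ->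
    Theta n alpha r (e * t) (xi_plus alpha (e * t)) <= e * Carg (q z0 + z0 * q1 / q z0)%C).
  { intros e He Hee. apply boundary_ray_estimate; auto.
    change (PI * alpha / 2) with beta. rewrite Hee. unfold sector_gap in Hg0. lra. }
  destruct (Rle_dec 0 (snd (q z0))) as [Hs|Hs].
  + specialize (Hest 1 ltac:(ring)). rewrite !Rmult_1_l, Rabs_pos_eq in Hest by exact Hs.
    specialize (Hest eq_refl). unfold Theta_plus in Hhi. lra.
  + specialize (Hest (-1) ltac:(ring)). rewrite (Rabs_left (snd (q z0))) in Hest by lra.
    specialize (Hest ltac:(ring)).
    replace (xi_plus alpha (-1 * t)) with (xi_minus alpha t) in Hest.
    2:{ unfold xi_plus, xi_minus. replace (-1 * t) with (- t) by ring.
      rewrite sin_neg, cos_neg. f_equal. ring. }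
    replace (Theta n alpha r (-1 * t) (xi_minus alpha t)) with (Theta_minus n alpha r t) in Hest.
    2:{ unfold Theta_minus, Theta. replace (-1 * t) with (- t) by ring. now rewrite cos_neg. }
    lra.
Qed.
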